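(* Let $T=(V,E)$ be a tree with $n$ nodes rooted at $v_1$, with leaf set $Y$ and a designated leaf $t_0$, and let $l\le w\le u$ be real edge vectors, $c>0$ an edge cost vector, and $D\in\mathbb{R}$. The problem (RIOVSPT$_{BH}$) can be solved in $O(n\log n)$ time; that is, there is an algorithm (Algorithm 1: binary search over the sorted distinct edge costs, testing feasibility of each candidate cost, followed by construction of a solution) that in $O(n\log n)$ time either correctly reports that the problem is infeasible or outputs an optimal solution $\tilde w$ together with its objective value $C(\tilde w)$.
   Context: For each leaf $t_k$, $P_k$ is the edge set of the path from $v_1$ to $t_k$; for $f:E\to\mathbb{R}$ and $S\subseteq E$, $f(S):=\sum_{e\in S}f(e)$. $H(a,b)=1$ if $a\neq b$ and $0$ otherwise. The problem (RIOVSPT$_{BH}$) is: minimize $C(\tilde w):=\max_{e\in E}c(e)H(\tilde w(e),w(e))$ over $\tilde w:E\to\mathbb{R}$ subject to $\tilde w(P_k)\ge D$ for all leaves $t_k$, $\tilde w(P_0)=D$, and $l(e)\le\tilde w(e)\le u(e)$ for all $e\in E$. *)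

(* Defs.v *)
From HB Require Import structures.
From mathcomp Require Import all_boot all_order all_algebra.
From mathcomp Require Import reals.
Set Implicit Arguments. Unset Strict Implicit. Unset Printing Implicit Defensive.
Import Order.TTheory GRing.Theory Num.Theory.
Local Open Scope ring_scope.

(** * Rooted trees

A tree with [n = m.+1] nodes has node set ['I_m.+1], rooted at [ord0], and edge
set ['I_m]: the edge [e] joins the non-root node [child e] to its parent
[par e].  The numbering of the nodes is arbitrary; in particular a node may
have a smaller number than its parent. *)

Definition child (m : nat) (e : 'I_m) : 'I_m.+1 := lift ord0 e.

Definition parent (m : nat) (par : 'I_m -> 'I_m.+1) (v : 'I_m.+1) : 'I_m.+1 :=
  if unlift ord0 v is Some e then par e else ord0.

Definition rooted_tree (m : nat) (par : 'I_m -> 'I_m.+1) : Prop :=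
  forall v, exists k, iter k (parent par) v = ord0.

Definition leaf (m : nat) (par : 'I_m -> 'I_m.+1) (v : 'I_m.+1) : Prop :=
  forall e, par e <> v.

(* The nodes of the path between [v] and the root are the iterates of [parent]
   on [v]; its edges are those joining such a node to its parent. *)
Definition root_path (m : nat) (par : 'I_m -> 'I_m.+1) (v : 'I_m.+1) :
    {set 'I_m} :=
  [set e | fconnect (parent par) v (child e)].

(** * The optimization problem *)

Definition weight (R : realType) (m : nat) (f : 'I_m -> R) (S : {set 'I_m}) : R :=
  \sum_(e in S) f e.

Definition hamming (R : realType) (a b : R) : R := if a != b then 1 else 0.

(* The terms are nonnegative when [0 < c], so the default value 0 of the
   maximum matters only for the tree without edges. *)
Definition objective (R : realType) (m : nat) (c w wt : 'I_m -> R) : R :=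
  \big[Num.max/0]_(e < m) (c e * hamming (wt e) (w e)).

Definition feasible (R : realType) (m : nat) (par : 'I_m -> 'I_m.+1)
    (t0 : 'I_m.+1) (l u : 'I_m -> R) (D : R) (wt : 'I_m -> R) : Prop :=
  [/\ forall t, leaf par t -> D <= weight wt (root_path par t),
      weight wt (root_path par t0) = D
    & forall e, l e <= wt e <= u e].

Definition optimal (R : realType) (m : nat) (par : 'I_m -> 'I_m.+1)
    (t0 : 'I_m.+1) (l w u c : 'I_m -> R) (D : R) (wt : 'I_m -> R) : Prop :=
  feasible par t0 l u D wt /\
  forall wt', feasible par t0 l u D wt' -> objective c w wt <= objective c w wt'.

(** * Real RAM

Programs act on finitely many (those named in the program text) integer
registers, real registers, integer arrays and real arrays, with indirect
addressing.  Every operation costs one time unit.  As usual for unit-cost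
models, integers have no multiplication and reals no rounding to integers; the
only constants are natural numbers, so no real number is hard-wired. *)

Inductive iexp : Type :=
  | ICst of nat
  | IReg of nat
  | IGet of nat & iexp         (* array, index *)
  | IAdd of iexp & iexp
  | ISub of iexp & iexp        (* truncated at 0 *)
  | IHalf of iexp.

Inductive rexp : Type :=
  | RCst of nat
  | RReg of nat
  | RGet of nat & iexp
  | RAdd of rexp & rexp
  | RSub of rexp & rexp
  | RMul of rexp & rexp
  | RDiv of rexp & rexp.       (* x / 0 = 0 *)

Inductive bexp : Type :=
  | ILe of iexp & iexp
  | RLe of rexp & rexp
  | BNot of bexp
  | BAnd of bexp & bexp.

Inductive cmd : Type :=
  | Skip
  | ISet of nat & iexp
  | RSet of nat & rexp
  | IPut of nat & iexp & iexp  (* array, index, value *)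
  | RPut of nat & iexp & rexp
  | Seq of cmd & cmd
  | If of bexp & cmd & cmd
  | While of bexp & cmd.

Record state (R : realType) : Type := State {
  ireg : nat -> nat;
  rreg : nat -> R;
  iarr : nat -> nat -> nat;
  rarr : nat -> nat -> R }.

Definition upd (T : Type) (f : nat -> T) (i : nat) (x : T) : nat -> T :=
  fun j => if j == i then x else f j.

Definition set_ireg (R : realType) (s : state R) (x k : nat) : state R :=
  State (upd (ireg s) x k) (rreg s) (iarr s) (rarr s).
Definition set_rreg (R : realType) (s : state R) (x : nat) (r : R) : state R :=
  State (ireg s) (upd (rreg s) x r) (iarr s) (rarr s).
Definition set_iarr (R : realType) (s : state R) (a i k : nat) : state R :=
  State (ireg s) (rreg s) (upd (iarr s) a (upd (iarr s a) i k)) (rarr s).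
Definition set_rarr (R : realType) (s : state R) (a i : nat) (r : R) : state R :=
  State (ireg s) (rreg s) (iarr s) (upd (rarr s) a (upd (rarr s a) i r)).

Fixpoint ieval (R : realType) (s : state R) (e : iexp) : nat :=
  match e with
  | ICst k => k
  | IReg x => ireg s x
  | IGet a e1 => iarr s a (ieval s e1)
  | IAdd e1 e2 => (ieval s e1 + ieval s e2)%N
  | ISub e1 e2 => (ieval s e1 - ieval s e2)%N
  | IHalf e1 => (ieval s e1)./2
  end.

Fixpoint reval (R : realType) (s : state R) (e : rexp) : R :=
  match e with
  | RCst k => k%:R
  | RReg x => rreg s x
  | RGet a e1 => rarr s a (ieval s e1)
  | RAdd e1 e2 => reval s e1 + reval s e2
  | RSub e1 e2 => reval s e1 - reval s e2
  | RMul e1 e2 => reval s e1 * reval s e2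
  | RDiv e1 e2 => reval s e1 / reval s e2
  end.

Fixpoint beval (R : realType) (s : state R) (b : bexp) : bool :=
  match b with
  | ILe e1 e2 => (ieval s e1 <= ieval s e2)%N
  | RLe e1 e2 => reval s e1 <= reval s e2
  | BNot b1 => ~~ beval s b1
  | BAnd b1 b2 => beval s b1 && beval s b2
  end.

Fixpoint icost (e : iexp) : nat :=
  match e with
  | ICst _ | IReg _ => 1
  | IGet _ e1 | IHalf e1 => (icost e1).+1
  | IAdd e1 e2 | ISub e1 e2 => (icost e1 + icost e2).+1
  end.

Fixpoint rcost (e : rexp) : nat :=
  match e with
  | RCst _ | RReg _ => 1
  | RGet _ e1 => (icost e1).+1
  | RAdd e1 e2 | RSub e1 e2 | RMul e1 e2 | RDiv e1 e2 => (rcost e1 + rcost e2).+1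
  end.

Fixpoint bcost (b : bexp) : nat :=
  match b with
  | ILe e1 e2 => (icost e1 + icost e2).+1
  | RLe e1 e2 => (rcost e1 + rcost e2).+1
  | BNot b1 => (bcost b1).+1
  | BAnd b1 b2 => (bcost b1 + bcost b2).+1
  end.

(* [exec p s t s']: started in [s], the program [p] halts in [s'] after exactly
   [t] time units. *)
Inductive exec (R : realType) : cmd -> state R -> nat -> state R -> Prop :=
  | ExSkip s : exec Skip s 1 s
  | ExISet s x e : exec (ISet x e) s (icost e).+1 (set_ireg s x (ieval s e))
  | ExRSet s x e : exec (RSet x e) s (rcost e).+1 (set_rreg s x (reval s e))
  | ExIPut s a i e :
      exec (IPut a i e) s (icost i + icost e).+1
        (set_iarr s a (ieval s i) (ieval s e))
  | ExRPut s a i e :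
      exec (RPut a i e) s (icost i + rcost e).+1
        (set_rarr s a (ieval s i) (reval s e))
  | ExSeq s1 s2 s3 p q t1 t2 :
      exec p s1 t1 s2 -> exec q s2 t2 s3 -> exec (Seq p q) s1 (t1 + t2)%N s3
  | ExIfT s s' b p q t :
      beval s b -> exec p s t s' -> exec (If b p q) s (bcost b + t).+1 s'
  | ExIfF s s' b p q t :
      ~~ beval s b -> exec q s t s' -> exec (If b p q) s (bcost b + t).+1 s'
  | ExWhileF s b p : ~~ beval s b -> exec (While b p) s (bcost b).+1 s
  | ExWhileT s1 s2 s3 b p t1 t2 :
      beval s1 b -> exec p s1 t1 s2 -> exec (While b p) s2 t2 s3 ->
      exec (While b p) s1 (bcost b + t1 + t2).+1 s3.

(** * Input and output *)

(* An array of data about edges: the entry of [e] is in the cell whose index is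
   the number of the node [child e]. *)
Definition edge_array (T : Type) (x0 : T) (m : nat) (f : 'I_m -> T) : nat -> T :=
  fun i => if i is j.+1 then oapp f x0 (insub j) else x0.

(* Integer registers 0, 1: the number of nodes and the designated leaf; real
   register 0: [D]; integer array 0: the parents; real arrays 0 to 3: [l], [w],
   [u], [c].  The rest of the memory is 0. *)
Definition input (R : realType) (m : nat) (par : 'I_m -> 'I_m.+1)
    (t0 : 'I_m.+1) (l w u c : 'I_m -> R) (D : R) : state R :=
  State (nth 0%N [:: m.+1; nat_of_ord t0])
        (nth 0 [:: D])
        (nth (fun=> 0%N) [:: edge_array 0%N (fun e => nat_of_ord (par e))])
        (nth (fun=> 0) [:: edge_array 0 l; edge_array 0 w;
                           edge_array 0 u; edge_array 0 c]).

(* Integer register 0: 0 for an infeasible instance, 1 otherwise; in the latter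
   case real array 4 is the solution and real register 0 its objective value. *)
Definition correct_output (R : realType) (m : nat) (par : 'I_m -> 'I_m.+1)
    (t0 : 'I_m.+1) (l w u c : 'I_m -> R) (D : R) (s : state R) : Prop :=
  let wt (e : 'I_m) := rarr s 4 (child e) in
  (ireg s 0 = 0%N /\ ~ (exists wt', feasible par t0 l u D wt')) \/
  [/\ ireg s 0 = 1%N, optimal par t0 l w u c D wt & rreg s 0 = objective c w wt].

(* [trunc_log 2 n] is the integer part of the binary logarithm, at least half
   of it for [n >= 2], so the rounding does not affect the class O(n log n). *)
Definition O_nlogn (T : nat -> nat) : Prop :=
  exists K N : nat, forall n, (N <= n)%N -> (T n <= K * (n * trunc_log 2 n))%N.

(* Main.v *)
Require Import Defs.
From HB Require Import structures.
From mathcomp Require Import all_boot all_order all_algebra.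
From mathcomp Require Import boolp reals zify lra.
Import Order.TTheory GRing.Theory Num.Theory.

Set Implicit Arguments. Unset Strict Implicit. Unset Printing Implicit Defensive.

(* A solution of objective value at most C is a solution whose edges of cost
   above C keep their weight.  Let H and L be the largest and the least distances
   from the root that these bounds allow.  In any such solution the distance of a
   node v of the path to t0 is at most min (H v) (L v + D - L t0), and that of a
   node off the path exceeds the one of its parent by at most the upper bound of
   the edge.  If L t0 <= D <= H t0, the weights with exactly these distances are
   within the bounds, so a linear pass over the nodes by increasing depth decides
   whether C is attainable.  The least attainable C is 0 or an edge cost, and is
   found by binary search in the sorted costs.  The depths, by which the nodes are
   sorted, are computed by pointer doubling. *)

(** * Rooted trees *)

Lemma child_inj m : injective (@child m).
Proof. exact: lift_inj. Qed.

Lemma child_eqE m (e e' : 'I_m) : (child e == child e' :> nat) = (e == e').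
Proof. by rewrite (inj_eq val_inj) (inj_eq (@child_inj m)). Qed.

Lemma edge_array_child (T : Type) (x0 : T) m (f : 'I_m -> T) (e : 'I_m) :
  edge_array x0 f (child e) = f e.
Proof. by rewrite lift0 /= valK. Qed.

Variant node_spec m : 'I_m.+1 -> Type :=
  | NodeRoot : node_spec ord0
  | NodeChild e : node_spec (child e).

Lemma nodeP m (v : 'I_m.+1) : node_spec v.
Proof. by case: (unliftP ord0 v) => [e|] ->; [exact: NodeChild|exact: NodeRoot]. Qed.

Lemma parent_root m (par : 'I_m -> 'I_m.+1) : parent par ord0 = ord0.
Proof. by rewrite /parent unlift_none. Qed.

Lemma parent_child m (par : 'I_m -> 'I_m.+1) e : parent par (child e) = par e.
Proof. by rewrite /parent liftK. Qed.

(* Keeps [/=] from turning [child e] into [bump 0 e]. *)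
Opaque child.

Section RootedTree.
Variables (m : nat) (par : 'I_m -> 'I_m.+1).

Lemma root_path_root : root_path par ord0 = set0.
Proof.
apply/setP => e; rewrite !inE; apply/negP => /iter_findex.
by rewrite (iter_fix _ (parent_root par)).
Qed.

Lemma root_path_child e : root_path par (child e) = e |: root_path par (par e).
Proof.
apply/setP => e'; rewrite !inE fconnect_eqVf parent_child.
by rewrite (inj_eq (@child_inj m)) eq_sym.
Qed.

Lemma root_path_subset e v :
  e \in root_path par v -> root_path par (child e) \subset root_path par v.
Proof.
rewrite inE => ve; apply/subsetP => e'; rewrite !inE; exact: connect_trans.
Qed.

Hypothesis rooted : rooted_tree par.

Lemma iter_parent_neq e k : iter k.+1 (parent par) (child e) != child e.
Proof.
apply/eqP => cycle; have [j to_root] := rooted (child e).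
have: iter (j * k.+1) (parent par) (child e) = child e by rewrite iterM iter_fix.
by rewrite mulnS addnC iterD to_root (iter_fix _ (parent_root par)).
Qed.

Lemma notin_root_path_par e : e \notin root_path par (par e).
Proof.
rewrite inE -parent_child; apply/negP => /iter_findex; rewrite -iterSr.
by apply/eqP; exact: iter_parent_neq.
Qed.

Definition depth (v : 'I_m.+1) : nat := #|root_path par v|.

Lemma depth_root : depth ord0 = 0.
Proof. by rewrite /depth root_path_root cards0. Qed.

Lemma depth_child e : depth (child e) = (depth (par e)).+1.
Proof. by rewrite /depth root_path_child cardsU1 notin_root_path_par. Qed.

Lemma depth_lt v : depth v < m.+1.
Proof. by rewrite ltnS -[leqRHS]card_ord max_card. Qed.

Lemma node_ind (Q : 'I_m.+1 -> Prop) :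
  Q ord0 -> (forall e, Q (par e) -> Q (child e)) -> forall v, Q v.
Proof.
move=> Q0 Qchild v; have [k] := ubnP (depth v); elim: k v => // k IH v.
case: (nodeP v) => // e; rewrite depth_child ltnS => lt_k.
exact/Qchild/IH.
Qed.

Local Open Scope ring_scope.
Variable R : realType.
Implicit Types f g : 'I_m -> R.

Lemma weight_le f g S : (forall e, f e <= g e) -> weight f S <= weight g S.
Proof. by move=> fg; apply: ler_sum. Qed.

Lemma weight_diff_subset f g (A B : {set 'I_m}) :
  (forall e, f e <= g e) -> A \subset B ->
  weight g A - weight f A <= weight g B - weight f B.
Proof.
move=> fg AB; rewrite /weight -!sumrB [leRHS](big_setID A) /= (setIidPr AB) lerDl.
by apply: sumr_ge0 => e _; rewrite subr_ge0.
Qed.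

Lemma weight_root f : weight f (root_path par ord0) = 0.
Proof. by rewrite /weight root_path_root big_set0. Qed.

Lemma weight_child f e :
  weight f (root_path par (child e)) = f e + weight f (root_path par (par e)).
Proof. by rewrite /weight root_path_child big_setU1 // notin_root_path_par. Qed.

Local Notation dist f v := (weight f (root_path par v)).

Section GreatestWeight.
Variables (t0 : 'I_m.+1) (lo hi : 'I_m -> R) (D : R).
Hypothesis lo_le_hi : forall e, lo e <= hi e.

(* The distance of a node v of the path to t0 is at most D minus the least
   distance from v to t0. *)
Definition capped_dist v : R :=
  Num.min (dist hi v) (dist lo v + (D - dist lo t0)).

Definition greatest_weight e : R :=
  if e \in root_path par t0 then capped_dist (child e) - capped_dist (par e)
  else hi e.

(* The increments of a minimum of two functions lie between theirs. *)
Lemma greatest_weight_bounds e : lo e <= greatest_weight e <= hi e.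
Proof.
have le_e := lo_le_hi e; rewrite /greatest_weight.
case: ifP => _; last by rewrite le_e /=.
rewrite /capped_dist !weight_child !minEle.
by do 2! case: ifP => ?; lra.
Qed.

Lemma dist_greatest_weight v :
  dist lo t0 <= D -> root_path par v \subset root_path par t0 ->
  dist greatest_weight v = capped_dist v.
Proof.
move=> lo_D; elim/node_ind: v => [_|e IH].
  by rewrite /capped_dist !weight_root add0r min_l // subr_ge0.
rewrite {1}root_path_child subUset sub1set => /andP[et0 /IH dist_par].
by rewrite weight_child dist_par /greatest_weight et0 subrK.
Qed.

Definition solvable_bounds : Prop :=
  dist lo t0 <= D <= dist hi t0 /\
  forall t, leaf par t -> D <= dist greatest_weight t.

Lemma greatest_weight_feasible :
  solvable_bounds -> feasible par t0 lo hi D greatest_weight.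
Proof.
move=> [/andP[lo_D D_hi] leaves]; split=> //; last exact: greatest_weight_bounds.
by rewrite dist_greatest_weight // /capped_dist addrC subrK min_r.
Qed.

Lemma dist_le_greatest_weight f v :
  (forall e, lo e <= f e <= hi e) -> dist f t0 = D ->
  dist f v <= dist greatest_weight v.
Proof.
move=> f_bounds f_D.
have lo_f e : lo e <= f e by case/andP: (f_bounds e).
have f_hi e : f e <= hi e by case/andP: (f_bounds e).
have lo_D : dist lo t0 <= D by rewrite -f_D; apply: weight_le.
elim/node_ind: v => [|e IH]; first by rewrite !weight_root.
have [et0|et0] := boolP (e \in root_path par t0); last first.
  by rewrite !weight_child /greatest_weight (negPf et0) lerD.
have sub_t0 := root_path_subset et0.
rewrite dist_greatest_weight // /capped_dist le_min weight_le //= -lerBlDl -f_D.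
exact: weight_diff_subset.
Qed.

Lemma feasible_solvable f : feasible par t0 lo hi D f -> solvable_bounds.
Proof.
move=> [leaves f_D f_bounds]; split=> [|t /leaves D_t].
  by rewrite -f_D !weight_le // => e; case/andP: (f_bounds e).
exact: le_trans D_t (dist_le_greatest_weight t f_bounds f_D).
Qed.

End GreatestWeight.

(** * Thresholds for the objective *)

Section Threshold.
Variables (t0 : 'I_m.+1) (l w u c : 'I_m -> R) (D : R).
Hypotheses (lwu : forall e, l e <= w e <= u e) (c_gt0 : forall e, 0 < c e).

Definition relax (C : R) (b : 'I_m -> R) e : R := if c e <= C then b e else w e.

Definition attainable (C : R) : Prop :=
  exists2 f, feasible par t0 l u D f & objective c w f <= C.

Definition cheapest_solution (C : R) : 'I_m -> R :=
  greatest_weight t0 (relax C l) (relax C u) D.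

Lemma relax_le C e : relax C l e <= relax C u e.
Proof. by rewrite /relax; case: ifP => // _; have := lwu e; lra. Qed.

Lemma objective_leP C f : 0 <= C ->
  reflect (forall e, f e != w e -> c e <= C) (objective c w f <= C).
Proof.
move=> C_ge0; rewrite /objective /hamming.
apply: (iffP (bigmax_leP _ _ _ _)) => [[_ le_C] e few|le_C].
  by have := le_C e isT; rewrite few mulr1.
split=> // e _; case: ifP => [/le_C|_]; first by rewrite mulr1.
by rewrite mulr0.
Qed.

Lemma feasible_relaxP C f : 0 <= C ->
  feasible par t0 (relax C l) (relax C u) D f <->
  feasible par t0 l u D f /\ objective c w f <= C.
Proof.
move=> C_ge0.
split=> [[leaves f_D f_bounds]|[[leaves f_D f_bounds] /objective_leP f_C]].
  split; [split=> // e|apply/objective_leP => // e];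
    have := f_bounds e; have := lwu e; rewrite /relax; case: ifP => // _; first by lra.
  by move=> _ /le_anti ->; rewrite eqxx.
split=> // e; rewrite /relax; have := f_bounds e; case: ifP => // ceC _.
have [->|/(f_C C_ge0)] := eqVneq (f e) (w e); first by rewrite lexx.
by rewrite ceC.
Qed.

Lemma cheapest_solutionP C : 0 <= C -> attainable C ->
  feasible par t0 l u D (cheapest_solution C) /\
  objective c w (cheapest_solution C) <= C.
Proof.
move=> C_ge0 [f f_feas f_C]; apply/feasible_relaxP => //.
apply: greatest_weight_feasible; first exact: relax_le.
by apply: (@feasible_solvable _ _ _ _ f); apply/feasible_relaxP.
Qed.

Lemma attainableP C : 0 <= C ->
  attainable C <-> solvable_bounds t0 (relax C l) (relax C u) D.
Proof.
move=> C_ge0; split=> [[f f_feas f_C]|].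
  by apply: (@feasible_solvable _ _ _ _ f); apply/feasible_relaxP.
move=> /greatest_weight_feasible-/(_ (relax_le C))/(feasible_relaxP _ C_ge0)[].
by exists (cheapest_solution C).
Qed.

Lemma attainable_mono C C' : C <= C' -> attainable C -> attainable C'.
Proof. by move=> CC' [f f_feas f_C]; exists f => //; apply: le_trans CC'. Qed.

(* The root has the entry 0, which is the objective of [w] itself. *)
Definition threshold : nat -> R := edge_array 0 c.

Lemma threshold_ge0 v : 0 <= threshold v.
Proof. by case: v => //= v; case: insubP => //= e _ _; exact: ltW. Qed.

Lemma objective_threshold f : exists v : 'I_m.+1, objective c w f = threshold v.
Proof.
rewrite /objective; elim/big_ind: _ => [|_ _ [v ->] [v' ->]|e _].
- by exists ord0.
- by case: leP => _; [exists v'|exists v].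
- rewrite /hamming; case: ifP => _; last by exists ord0; rewrite mulr0.
  by exists (child e); rewrite mulr1 /threshold edge_array_child.
Qed.

Lemma attainable_objective f : feasible par t0 l u D f ->
  exists2 v : 'I_m.+1, objective c w f = threshold v & attainable (threshold v).
Proof.
move=> f_feas; have [v f_v] := objective_threshold f.
by exists v => //; exists f; rewrite ?f_v.
Qed.

Lemma cheapest_solution_optimal C : 0 <= C -> attainable C ->
  (forall v : 'I_m.+1, attainable (threshold v) -> C <= threshold v) ->
  optimal par t0 l w u c D (cheapest_solution C) /\
  C = objective c w (cheapest_solution C).
Proof.
move=> C_ge0 /(cheapest_solutionP C_ge0)[sol_feas sol_C] C_least.
have C_le f : feasible par t0 l u D f -> C <= objective c w f.
  by move=> /attainable_objective[v -> /C_least].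
split; last by apply: le_anti; rewrite sol_C C_le.
by split=> // f /C_le; apply: le_trans.
Qed.

End Threshold.
End RootedTree.

(** * Programs *)

Arguments upd T f i x j /.

Notation "p ;; q" := (Seq p q) (at level 80, right associativity).

Definition ILt (e1 e2 : iexp) : bexp := BNot (ILe e2 e1).
Definition IMin (e1 e2 : iexp) : iexp := ISub e1 (ISub e1 e2).

Variant location : Type :=
  | IRegAt of nat | RRegAt of nat | IArrAt of nat | RArrAt of nat.

Definition location_encode (x : location) : (nat + nat) + (nat + nat) :=
  match x with
  | IRegAt i => inl (inl i) | RRegAt i => inl (inr i)
  | IArrAt i => inr (inl i) | RArrAt i => inr (inr i)
  end.

Definition location_decode (x : (nat + nat) + (nat + nat)) : location :=
  match x with
  | inl (inl i) => IRegAt i | inl (inr i) => RRegAt i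
  | inr (inl i) => IArrAt i | inr (inr i) => RArrAt i
  end.

Lemma location_encodeK : cancel location_encode location_decode.
Proof. by case. Qed.

HB.instance Definition _ := Equality.copy location (can_type location_encodeK).

Fixpoint writes (p : cmd) : seq location :=
  match p with
  | Skip => [::]
  | ISet x _ => [:: IRegAt x]
  | RSet x _ => [:: RRegAt x]
  | IPut a _ _ => [:: IArrAt a]
  | RPut a _ _ => [:: RArrAt a]
  | p ;; q | If _ p q => writes p ++ writes q
  | While _ p => writes p
  end.

(* The value at [While] is junk: [loopfree_wp] excludes loops. *)
Fixpoint loopfree_cost (p : cmd) : nat :=
  match p with
  | Skip => 1
  | ISet _ e => (icost e).+1
  | RSet _ e => (rcost e).+1
  | IPut _ i e => (icost i + icost e).+1
  | RPut _ i e => (icost i + rcost e).+1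
  | p ;; q => loopfree_cost p + loopfree_cost q
  | If b p q => (bcost b + maxn (loopfree_cost p) (loopfree_cost q)).+1
  | While _ _ => 0
  end.

Section ProgramLogic.
Variable R : realType.
Implicit Types (s : state R) (p q : cmd) (P Q : state R -> Prop).

Definition content_type (x : location) : Type :=
  match x with
  | IRegAt _ => nat | RRegAt _ => R | IArrAt _ => nat -> nat | RArrAt _ => nat -> R
  end.

Definition content s (x : location) : content_type x :=
  match x with
  | IRegAt i => ireg s i | RRegAt i => rreg s i
  | IArrAt a => iarr s a | RArrAt a => rarr s a
  end.

Definition agree_off (W : seq location) s s' : Prop :=
  forall x, x \notin W -> content s' x = content s x.

Lemma agree_off_sub W W' s s' :
  {subset W <= W'} -> agree_off W s s' -> agree_off W' s s'.
Proof. by move=> WW' ag x xW'; apply: ag; apply: contra xW' => /WW'. Qed.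

Lemma agree_off_trans W s1 s2 s3 :
  agree_off W s1 s2 -> agree_off W s2 s3 -> agree_off W s1 s3.
Proof. by move=> ag12 ag23 x xW; rewrite ag23 ?ag12. Qed.

Lemma agree_off_cat W W' s1 s2 s3 :
  agree_off W s1 s2 -> agree_off W' s2 s3 -> agree_off (W ++ W') s1 s3.
Proof.
by move=> ag12 ag23 x; rewrite mem_cat negb_or => /andP[xW xW']; rewrite ag23 ?ag12.
Qed.

Lemma agree_off_set_ireg W s i k : IRegAt i \in W -> agree_off W s (set_ireg s i k).
Proof.
by move=> iW [j|j|j|j] //= jW; rewrite ifN //; apply: contraNneq jW => ->.
Qed.

Lemma agree_off_ireg W s s' i :
  agree_off W s s' -> IRegAt i \notin W -> ireg s' i = ireg s i.
Proof. by move=> ag /ag. Qed.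

Lemma agree_off_rreg W s s' i :
  agree_off W s s' -> RRegAt i \notin W -> rreg s' i = rreg s i.
Proof. by move=> ag /ag. Qed.

Lemma agree_off_iarr W s s' a :
  agree_off W s s' -> IArrAt a \notin W -> iarr s' a = iarr s a.
Proof. by move=> ag /ag. Qed.

Lemma agree_off_rarr W s s' a :
  agree_off W s s' -> RArrAt a \notin W -> rarr s' a = rarr s a.
Proof. by move=> ag /ag. Qed.

Lemma exec_agree_off p s t s' : exec p s t s' -> agree_off (writes p) s s'.
Proof.
elim=> {p s t s'} //=.
- by move=> s x e [y|y|y|y] //=; rewrite inE => yx; rewrite ifN.
- by move=> s x e [y|y|y|y] //=; rewrite inE => yx; rewrite ifN.
- by move=> s a i e [y|y|y|y] //=; rewrite inE => ya; rewrite ifN.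
- by move=> s a i e [y|y|y|y] //=; rewrite inE => ya; rewrite ifN.
- by move=> s1 s2 s3 p q t1 t2 _ + _; exact: agree_off_cat.
- by move=> s s' b p q t _ _; apply: agree_off_sub => x; rewrite mem_cat => ->.
- by move=> s s' b p q t _ _; apply: agree_off_sub => x; rewrite mem_cat orbC => ->.
- by move=> s1 s2 s3 b p t1 t2 _ _ + _; exact: agree_off_trans.
Qed.

Definition runs p s (B : nat) Q : Prop :=
  exists t s', [/\ exec p s t s', t <= B & Q s'].

Lemma runs_weaken p s B B' Q Q' :
  runs p s B Q -> B <= B' ->
  (forall s', agree_off (writes p) s s' -> Q s' -> Q' s') -> runs p s B' Q'.
Proof.
move=> [t [s' [ex tB Qs']]] BB' QQ'; exists t, s'; split=> //.
  exact: leq_trans tB BB'.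
exact: QQ' (exec_agree_off ex) Qs'.
Qed.

Lemma runs_seq B1 P p q s B Q :
  runs p s B1 P -> B1 <= B ->
  (forall s', agree_off (writes p) s s' -> P s' -> runs q s' (B - B1) Q) ->
  runs (p ;; q) s B Q.
Proof.
move=> [t [s' [ex tB1 Ps']]] B1B runs_q.
have [t' [s'' [ex' tB Qs'']]] := runs_q s' (exec_agree_off ex) Ps'.
exists (t + t'), s''; split=> //; first exact: ExSeq ex ex'.
by move: tB1 tB B1B; lia.
Qed.

Lemma runs_if b p q s B Q :
  (beval s b -> runs p s B Q) -> (~~ beval s b -> runs q s B Q) ->
  runs (If b p q) s (bcost b + B).+1 Q.
Proof.
move=> runs_p runs_q; have [bs|bs] := boolP (beval s b).
  have [t [s' [ex tB Qs']]] := runs_p bs.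
  by exists (bcost b + t).+1, s'; rewrite ltnS leq_add2l; split=> //; apply: ExIfT.
have [t [s' [ex tB Qs']]] := runs_q bs.
by exists (bcost b + t).+1, s'; rewrite ltnS leq_add2l; split=> //; apply: ExIfF.
Qed.

Fixpoint loopfree_wp p s Q : Prop :=
  match p with
  | Skip => Q s
  | ISet x e => Q (set_ireg s x (ieval s e))
  | RSet x e => Q (set_rreg s x (reval s e))
  | IPut a i e => Q (set_iarr s a (ieval s i) (ieval s e))
  | RPut a i e => Q (set_rarr s a (ieval s i) (reval s e))
  | p ;; q => loopfree_wp p s (fun s' => loopfree_wp q s' Q)
  | If b p q =>
      (beval s b -> loopfree_wp p s Q) /\ (~~ beval s b -> loopfree_wp q s Q)
  | While _ _ => False
  end.

Lemma runs_loopfree_cost p s Q : loopfree_wp p s Q -> runs p s (loopfree_cost p) Q.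
Proof.
elim: p s Q => //= [|x e|x e|a i e|a i e|p IHp q IHq|b p IHp q IHq] s Q.
- by move=> Qs; exists 1, s; split=> //; apply: ExSkip.
- by eexists _, _; split; [apply: ExISet| |].
- by eexists _, _; split; [apply: ExRSet| |].
- by eexists _, _; split; [apply: ExIPut| |].
- by eexists _, _; split; [apply: ExRPut| |].
- move=> /IHp runs_p; apply: (runs_seq runs_p (leq_addr _ _)) => s' _ /IHq.
  by rewrite addKn.
- by move=> [wp_p wp_q]; apply: runs_if => [/wp_p/IHp|/wp_q/IHq] h;
     apply: (runs_weaken h); rewrite ?leq_maxl ?leq_maxr.
Qed.

Lemma runs_loopfree p s B Q :
  loopfree_cost p <= B -> loopfree_wp p s Q -> runs p s B Q.
Proof. by move=> cost_B /runs_loopfree_cost/runs_weaken; apply. Qed.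

Lemma runs_seq_loopfree p q s B Q :
  loopfree_cost p <= B ->
  loopfree_wp p s (fun s' => runs q s' (B - loopfree_cost p) Q) ->
  runs (p ;; q) s B Q.
Proof. by move=> cost_B /runs_loopfree_cost/runs_seq; apply. Qed.

Lemma runs_while (I : nat -> state R -> Prop) b p B s0 k0 :
  (forall k s, agree_off (writes p) s0 s -> I k s -> beval s b ->
     exists2 k', k' < k & runs p s B (I k')) ->
  I k0 s0 ->
  runs (While b p) s0 (k0 * (bcost b + B).+1 + (bcost b).+1)
    (fun s' => ~~ beval s' b /\ exists k, I k s').
Proof.
move=> step; have: agree_off (writes p) s0 s0 by [].
move: {2 3 4}s0 => s; elim/ltn_ind: k0 s => k IH s ag Is.
have [bs|bs] := boolP (beval s b); last first.
  exists (bcost b).+1, s; rewrite leq_addl; split=> //; first exact: ExWhileF.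
  by split=> //; exists k.
have [k' k'k [t [s' [ex tB Is']]]] := step _ _ ag Is bs.
have ag' := agree_off_trans ag (exec_agree_off ex).
have [t' [s'' [ex' tB' Qs'']]] := IH _ k'k _ ag' Is'.
exists (bcost b + t + t').+1, s''; split=> //; first exact: ExWhileT ex'.
have: k'.+1 * (bcost b + B).+1 <= k * (bcost b + B).+1 by rewrite leq_mul2r k'k orbT.
by rewrite mulSn; move: tB tB'; lia.
Qed.

End ProgramLogic.

Definition Loop (x y init : nat) (next : iexp) (p : cmd) : cmd :=
  ISet x (ICst init) ;;
  While (ILt (IReg x) (IReg y)) (p ;; ISet x next).

Definition For (x y : nat) : cmd -> cmd := Loop x y 0 (IAdd (IReg x) (ICst 1)).

Definition Doubling (x y : nat) : cmd -> cmd := Loop x y 1 (IAdd (IReg x) (IReg x)).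

Section Loops.
Variables (R : realType) (x y : nat) (p : cmd) (n : nat) (s : state R).
Hypotheses (neq_xy : x != y) (p_x : IRegAt x \notin writes p)
  (p_y : IRegAt y \notin writes p) (s_y : ireg s y = n).

Lemma runs_loop (I : nat -> state R -> Prop) init next (g : nat -> nat) K B :
  (forall s1 : state R, ieval s1 next = g (ireg s1 x)) -> n <= iter K g init ->
  (forall k s1 v, I k s1 -> I k (set_ireg s1 x v)) -> I 0 s ->
  (forall k s1, iter k g init < n -> agree_off (writes (Loop x y init next p)) s s1 ->
     ireg s1 x = iter k g init -> I k s1 -> runs p s1 B (I k.+1)) ->
  runs (Loop x y init next p) s (K * (B + icost next + 6) + 7)
    (fun s' => exists k, [/\ k <= K, n <= iter k g init & I k s']).
Proof.
move=> next_g n_K I_x I0 step; set W := writes (Loop x y init next p).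
have neq_yx : y != x by rewrite eq_sym.
have W_y : IRegAt y \notin W by rewrite inE mem_cat inE !negb_or p_y; apply/and3P.
pose at_round r s1 := exists k, [/\ k + r = K, ireg s1 x = iter k g init & I k s1].
set body := p ;; ISet x next; set s0 := set_ireg s x init.
have ag_s0 : agree_off W s s0 by apply: agree_off_set_ireg; rewrite inE eqxx.
have ag_W s1 : agree_off (writes body) s0 s1 -> agree_off W s s1.
  move=> ag; apply: agree_off_trans ag_s0 (agree_off_sub _ ag) => z.
  by rewrite inE orbC => ->.
apply: runs_seq_loopfree => /=; first lia.
have start : at_round K s0 by exists 0; rewrite /= eqxx; split=> //; apply: I_x.
have loop := @runs_while R at_round (ILt (IReg x) (IReg y)) body
  (B + (icost next).+1) s0 K.
apply: (runs_weaken (loop _ start)) => [r s1 /ag_W ag|/=|s1 /ag_W ag].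
- move=> [k [kr s1x Ik]]; rewrite /= (agree_off_ireg ag) // s_y s1x -ltnNge => lt_n.
  have r_gt0 : 0 < r.
    by case: r kr => // kr; move: lt_n; rewrite ltnNge -[k]addn0 kr n_K.
  exists r.-1; first by rewrite prednK.
  apply: (runs_seq (step k s1 lt_n ag s1x Ik)); first exact: leq_addr.
  move=> s2 ag12 Ik1; apply: runs_loopfree => /=; first lia.
  exists k.+1; rewrite /= eqxx next_g (agree_off_ireg ag12) // s1x; split=> //.
    by lia.
  exact: I_x.
- lia.
- move=> [guard [r [k [kr s1x Ik]]]]; exists k; split=> //; first lia.
  by move: guard; rewrite /= negbK s1x (agree_off_ireg ag) // s_y.
Qed.

Lemma runs_for (I : nat -> state R -> Prop) B :
  (forall k s1 v, I k s1 -> I k (set_ireg s1 x v)) -> I 0 s ->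
  (forall k s1, k < n -> agree_off (writes (For x y p)) s s1 ->
     ireg s1 x = k -> I k s1 -> runs p s1 B (I k.+1)) ->
  runs (For x y p) s (n * (B + 9) + 7) (I n).
Proof.
move=> I_x I0 step; have iter_succ k : iter k succn 0 = k by elim: k => //= k ->.
apply: (runs_weaken
  (runs_loop (I := I) (g := succn) (K := n) (B := B) _ _ I_x I0 _)) => //.
- by move=> s1; rewrite /= addn1.
- by rewrite iter_succ.
- by move=> k s1; rewrite iter_succ; apply: step.
- by rewrite /=; lia.
- by move=> s' _ [k [kn]]; rewrite iter_succ => nk; have -> : k = n by lia.
Qed.

Lemma runs_foreach (Q : 'I_n -> state R -> Prop) :
  (forall (i : 'I_n) s1 v, Q i s1 -> Q i (set_ireg s1 x v)) ->
  (forall (i : 'I_n) s1, agree_off (writes (For x y p)) s s1 -> ireg s1 x = i ->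
     loopfree_wp p s1 (fun s2 =>
       Q i s2 /\ forall j : 'I_n, j != i :> nat -> Q j s1 -> Q j s2)) ->
  runs (For x y p) s (n * (loopfree_cost p + 9) + 7) (fun s' => forall i, Q i s').
Proof.
move=> Q_x step; pose I k s1 := forall i : 'I_n, i < k -> Q i s1.
apply: (runs_weaken (@runs_for I _ _ _ _)) =>
  // [k s1 v Is1 i ik|k s1 kn ag s1x Is1|s1 _ Is1 i].
- exact/Q_x/Is1.
- have := step (Ordinal kn) s1 ag s1x.
  move=> /runs_loopfree_cost/runs_weaken; apply=> // s2 _ [Qk Qs2] i.
  rewrite ltnS leq_eqVlt => /predU1P[ik|ik].
    by have -> : i = Ordinal kn by apply: val_inj.
  by apply: Qs2; [rewrite ltn_eqF|apply: Is1].
- exact: Is1.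
Qed.

Lemma runs_doubling (I : nat -> state R -> Prop) B :
  (forall w s1 v, I w s1 -> I w (set_ireg s1 x v)) -> I 1 s ->
  (forall w s1, 0 < w < n -> agree_off (writes (Doubling x y p)) s s1 ->
     ireg s1 x = w -> I w s1 -> runs p s1 B (I (w + w))) ->
  runs (Doubling x y p) s ((trunc_log 2 n).+1 * (B + 9) + 7)
    (fun s' => exists2 w, n <= w & I w s').
Proof.
move=> I_x I1 step; pose double w := w + w.
have iter_double k : iter k double 1 = 2 ^ k.
  by elim: k => //= k ->; rewrite expnS mul2n -addnn.
apply: (runs_weaken (runs_loop (I := fun k => I (2 ^ k)) (init := 1) (g := double)
  (K := (trunc_log 2 n).+1) (B := B) _ _ _ I1 _)) => //.
- by rewrite iter_double ltnW // trunc_log_ltn.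
- by move=> k; apply: I_x.
- move=> k s1; rewrite iter_double expnS mul2n -addnn => kn; apply: step.
  by rewrite expn_gt0.
- by rewrite /=; lia.
- by move=> s' _ [k [_]]; rewrite iter_double; exists (2 ^ k).
Qed.

End Loops.

(** * Memory layout *)

(* The verdict and the value replace the number of nodes and [D]. *)
Notation nodes_reg := 0 (only parsing).
Notation verdict_reg := 0 (only parsing).
Notation target_reg := 1 (only parsing).
Notation counter_reg := 2 (only parsing).
Notation width_reg := 3 (only parsing).
Notation left_reg := 4 (only parsing).
Notation right_reg := 5 (only parsing).
Notation left_end_reg := 6 (only parsing).
Notation right_end_reg := 7 (only parsing).
Notation node_reg := 8 (only parsing).
Notation passed_reg := 9 (only parsing).
Notation low_reg := 10 (only parsing).
Notation high_reg := 11 (only parsing).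
Notation mid_reg := 12 (only parsing).

Notation counter := (IReg counter_reg) (only parsing).
Notation node := (IReg node_reg) (only parsing).

Notation total_reg := 0 (only parsing).
Notation value_reg := 0 (only parsing).
Notation threshold_reg := 1 (only parsing).

Notation parent_arr := 0 (only parsing).
Notation ancestor_arr := 1 (only parsing).
Notation by_depth_arr := 2 (only parsing).
Notation by_cost_arr := 3 (only parsing).
Notation merged_arr := 4 (only parsing).
Notation on_path_arr := 5 (only parsing).
Notation inner_arr := 6 (only parsing).

Notation l_arr := 0 (only parsing).
Notation w_arr := 1 (only parsing).
Notation u_arr := 2 (only parsing).
Notation cost_arr := 3 (only parsing).
Notation solution_arr := 4 (only parsing).
Notation depth_arr := 5 (only parsing).
Notation lower_arr := 6 (only parsing).
Notation upper_arr := 7 (only parsing).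
Notation least_dist_arr := 8 (only parsing).
Notation greatest_dist_arr := 9 (only parsing).
Notation capped_dist_arr := 10 (only parsing).
Notation dist_arr := 11 (only parsing).

(** * Merge sort *)

Section Slice.
Variable T : Type.
Implicit Types f g : nat -> T.

Definition slice f (i j : nat) : seq T := [seq f x | x <- index_iota i j].

Lemma size_slice f i j : size (slice f i j) = j - i.
Proof. by rewrite size_map size_iota. Qed.

Lemma nth_slice x0 f i j x : x < j - i -> nth x0 (slice f i j) x = f (i + x).
Proof. by move=> xij; rewrite (nth_map 0) ?size_iota // nth_iota. Qed.

Lemma slice_nil f i j : j <= i -> slice f i j = [::].
Proof. by rewrite /slice /index_iota -subn_eq0 => /eqP ->. Qed.

Lemma slice_cons f i j : i < j -> slice f i j = f i :: slice f i.+1 j.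
Proof.
by move=> ij; rewrite /slice /index_iota subnS -(prednK (n := j - i)) ?subn_gt0.
Qed.

Lemma slice_cat f i j k : i <= j <= k -> slice f i k = slice f i j ++ slice f j k.
Proof.
move=> /andP[ij jk]; rewrite /slice -map_cat /index_iota.
by rewrite -[in X in iota X (k - j)](subnKC ij) -iotaD addnBAC // subnKC.
Qed.

Lemma slice_rcons f i j : i <= j -> slice f i j.+1 = rcons (slice f i j) (f j).
Proof.
move=> ij; rewrite (@slice_cat _ i j) ?ij ?leqnSn // (slice_cons f (ltnSn j)).
by rewrite (slice_nil f (leqnn _)) cats1.
Qed.

Lemma eq_slice f g i j :
  (forall x, i <= x < j -> f x = g x) -> slice f i j = slice g i j.
Proof. by move=> fg; apply/eq_in_map => x; rewrite mem_index_iota => /fg. Qed.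

Lemma slice_upd f i j k z : j <= k -> slice (upd f k z) i j = slice f i j.
Proof. by move=> jk; apply: eq_slice => x ?; rewrite /= ifN //; lia. Qed.

Lemma slice_upd_rcons f i j z :
  i <= j -> slice (upd f j z) i j.+1 = rcons (slice f i j) z.
Proof. by move=> ij; rewrite slice_rcons // slice_upd //= eqxx. Qed.

End Slice.

Lemma merge_consl (T : Type) (leT : rel T) x s1 s2 :
  (if s2 is y :: _ then leT x y else true) ->
  merge leT (x :: s1) s2 = x :: merge leT s1 s2.
Proof. by case: s2 => [|y s2] /= => [_|->]; [case: s1|]. Qed.

Lemma merge_consr (T : Type) (leT : rel T) y s1 s2 :
  (if s1 is x :: _ then ~~ leT x y else true) ->
  merge leT s1 (y :: s2) = y :: merge leT s1 s2.
Proof. by case: s1 => [|x s1] //= /negPf ->. Qed.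

Section MergeInvariant.
Variables (leT : rel nat) (n w : nat) (A : nat -> nat).
Hypothesis leT_total : total leT.

Definition sorted_blocks (v len : nat) (f : nat -> nat) : Prop :=
  forall q, sorted leT (slice f (q * v) (minn (q * v + v) len)).

(* The output [B] is complete up to [start], and merging the remainders
   [i, mid) and [j, hi) of two blocks of width [w] completes its next block. *)
Record merging (start i j mid hi k : nat) (B : nat -> nat) : Prop := Merging {
  merging_start : (w + w) %| start;
  merging_mid : mid = minn (start + w) n;
  merging_hi : hi = minn (mid + w) n;
  merging_i : start <= i <= mid;
  merging_j : mid <= j <= hi;
  merging_k : k + mid = i + j;
  merging_block : slice B start k ++ merge leT (slice A i mid) (slice A j hi) =
                  merge leT (slice A start mid) (slice A mid hi);
  merging_sorted : sorted_blocks (w + w) start B;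
  merging_perm : perm_eq (slice B 0 start) (slice A 0 start) }.

Lemma merging_open k B :
  (w + w) %| k -> k < n -> sorted_blocks (w + w) k B ->
  perm_eq (slice B 0 k) (slice A 0 k) ->
  let mid := minn (k + w) n in merging k k mid mid (minn (mid + w) n) k B.
Proof. by move=> wk kn; split=> //; rewrite ?(slice_nil B (leqnn k)) //; lia. Qed.

Lemma merging_push start i i' j j' mid hi k z B :
  merging start i j mid hi k B -> i <= i' <= mid -> j <= j' <= hi ->
  i' + j' = (i + j).+1 ->
  merge leT (slice A i mid) (slice A j hi) =
    z :: merge leT (slice A i' mid) (slice A j' hi) ->
  merging start i' j' mid hi k.+1 (upd B k z).
Proof.
case=> start_w mid_def hi_def i_bounds j_bounds k_def block sortedB permB.
move=> i'_bounds j'_bounds next merge_z; split=> //; try lia.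
- by rewrite slice_upd_rcons ?cat_rcons -?merge_z //; lia.
- by move=> q; rewrite slice_upd //; lia.
- by rewrite slice_upd //; lia.
Qed.

Lemma merging_left start i j mid hi k B :
  merging start i j mid hi k B -> i < mid -> (j < hi -> leT (A i) (A j)) ->
  merging start i.+1 j mid hi k.+1 (upd B k (A i)).
Proof.
move=> mg lt_i le_ij; have j_bounds := merging_j mg.
apply: (merging_push mg); try lia; rewrite (slice_cons A lt_i) merge_consl //.
by case: (ltnP j hi) => lt_j; [rewrite slice_cons ?le_ij|rewrite slice_nil].
Qed.

Lemma merging_right start i j mid hi k B :
  merging start i j mid hi k B -> j < hi -> (i < mid -> ~~ leT (A i) (A j)) ->
  merging start i j.+1 mid hi k.+1 (upd B k (A j)).
Proof.
move=> mg lt_j gt_ij; have i_bounds := merging_i mg.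
apply: (merging_push mg); try lia; rewrite (slice_cons A lt_j) merge_consr //.
by case: (ltnP i mid) => lt_i; [rewrite slice_cons ?gt_ij|rewrite slice_nil].
Qed.

Lemma sorted_blocks_extend v start hi B :
  v %| start -> start <= hi <= start + v -> sorted_blocks v start B ->
  sorted leT (slice B start hi) -> sorted_blocks v hi B.
Proof.
move=> /dvdnP[r ->] hi_bounds sortedB sorted_last q.
case: (ltngtP q r) => [qr|rq|->].
- have: q.+1 * v <= r * v by rewrite leq_mul2r qr orbT.
  by rewrite mulSn => qr'; have := sortedB q; rewrite !(minn_idPl _) //; lia.
- have: r.+1 * v <= q * v by rewrite leq_mul2r rq orbT.
  by rewrite mulSn => rq'; rewrite slice_nil //; lia.
- by rewrite (minn_idPr _) //; lia.
Qed.

Lemma merging_close start i j mid hi B :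
  merging start i j mid hi hi B -> sorted_blocks w n A ->
  [/\ sorted_blocks (w + w) hi B, perm_eq (slice B 0 hi) (slice A 0 hi)
    & hi < n -> (w + w) %| hi].
Proof.
case=> start_w mid_def hi_def i_bounds j_bounds k_def block sortedB permB sortedA.
have {}block : slice B start hi = merge leT (slice A start mid) (slice A mid hi).
  by rewrite -block !(@slice_nil _ A) ?cats0 //; lia.
split.
- apply: sorted_blocks_extend sortedB _ => //; first lia.
  have [r start_r] : exists r, start = r * (w + w) by apply/dvdnP.
  rewrite block merge_sorted //.
    by have := sortedA (r * 2); rewrite (_ : r * 2 * w = start) -?mid_def //; lia.
  have := sortedA (r * 2).+1; rewrite (_ : (r * 2).+1 * w = start + w); last lia.
  case: (leqP (start + w) n) => le_n.
    by rewrite hi_def mid_def (minn_idPl le_n).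
  by rewrite !slice_nil //; lia.
- rewrite !(@slice_cat _ _ 0 start hi); try lia.
  by apply: perm_cat permB _; rewrite block perm_merge -slice_cat //; lia.
- by move=> hi_n; have -> : hi = start + (w + w) by [lia]; rewrite dvdn_addl.
Qed.

End MergeInvariant.

Section Sorts.
Variables (d : Order.disp_t) (T : orderType d).
Variables (key : nat -> T) (n : nat) (order : nat -> nat).

Definition sorts : Prop :=
  sorted (relpre key <=%O) (slice order 0 n) /\ perm_eq (slice order 0 n) (iota 0 n).

Hypothesis sorts_order : sorts.

Lemma mem_sorts v : (v \in slice order 0 n) = (v < n).
Proof. by case: sorts_order => _ /perm_mem->; rewrite mem_iota. Qed.

Lemma sorts_lt x : x < n -> order x < n.
Proof. by move=> xn; rewrite -mem_sorts map_f // mem_index_iota. Qed.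

Lemma sorts_surj v : v < n -> exists2 x, x < n & order x = v.
Proof.
by rewrite -mem_sorts => /mapP[x]; rewrite mem_index_iota => xn ->; exists x.
Qed.

Lemma sorts_le x y : x <= y -> y < n -> (key (order x) <= key (order y))%O.
Proof.
move=> xy yn; have key_trans : transitive (relpre key <=%O).
  by move=> ? ? ? /=; apply: le_trans.
have := sorted_leq_nth key_trans (fun=> lexx _) 0 sorts_order.1.
move=> /(_ x y); rewrite !inE size_slice subn0 !nth_slice ?subn0 //=; last lia.
by apply=> //; lia.
Qed.

Lemma sorts_lt_index x j : x < n -> j < n -> (key x < key (order j))%O ->
  exists2 i, i < j & order i = x.
Proof.
move=> /sorts_surj[i i_n <-] j_n key_lt; exists i => //; rewrite ltnNge.
by apply/negP => /sorts_le-/(_ i_n); rewrite leNgt key_lt.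
Qed.

End Sorts.

Definition open_blocks : cmd :=
  ISet left_reg counter ;;
  ISet left_end_reg (IMin (IAdd counter (IReg width_reg)) (IReg nodes_reg)) ;;
  ISet right_reg (IReg left_end_reg) ;;
  ISet right_end_reg
    (IMin (IAdd (IReg left_end_reg) (IReg width_reg)) (IReg nodes_reg)).

Definition merge_choose (key arr : nat) : cmd :=
  If (BAnd (ILt (IReg left_reg) (IReg left_end_reg))
           (BNot (BAnd (ILt (IReg right_reg) (IReg right_end_reg))
                       (BNot (RLe (RGet key (IGet arr (IReg left_reg)))
                                  (RGet key (IGet arr (IReg right_reg))))))))
    (IPut merged_arr counter (IGet arr (IReg left_reg)) ;;
     ISet left_reg (IAdd (IReg left_reg) (ICst 1)))
    (IPut merged_arr counter (IGet arr (IReg right_reg)) ;;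
     ISet right_reg (IAdd (IReg right_reg) (ICst 1))).

Definition merge_step (key arr : nat) : cmd :=
  If (ILe (IReg right_end_reg) counter) open_blocks Skip ;;
  merge_choose key arr.

Definition copy_merged (arr : nat) : cmd :=
  For counter_reg nodes_reg
    (IPut arr counter (IGet merged_arr counter)).

Definition merge_blocks (key arr : nat) : cmd :=
  ISet counter_reg (ICst 0) ;;
  open_blocks ;;
  For counter_reg nodes_reg (merge_step key arr) ;;
  copy_merged arr.

Definition list_nodes (arr : nat) : cmd :=
  For counter_reg nodes_reg (IPut arr counter counter).

Definition merge_sort (key arr : nat) : cmd :=
  list_nodes arr ;;
  Doubling width_reg nodes_reg (merge_blocks key arr).

Section MergeSort.
Variables (R : realType) (n key arr : nat).
Hypotheses (n_gt0 : 0 < n) (arr_merged : arr != merged_arr).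
Implicit Types s : state R.

Let arr_mergedF : (IArrAt arr == IArrAt merged_arr) = false.
Proof. exact: negPf arr_merged. Qed.

Definition key_le s : rel nat := relpre (rarr s key) <=%R.

Lemma key_le_total s : total (key_le s).
Proof. by move=> x y; apply: le_total. Qed.

Definition merging_state (s0 : state R) (w k : nat) s : Prop :=
  exists start, merging (key_le s0) n w (iarr s0 arr) start (ireg s left_reg)
    (ireg s right_reg) (ireg s left_end_reg) (ireg s right_end_reg) k
    (iarr s merged_arr).

Lemma open_blocks_runs s0 w k s :
  ireg s nodes_reg = n -> ireg s width_reg = w -> ireg s counter_reg = k ->
  0 < w -> k < n -> (w + w) %| k ->
  sorted_blocks (key_le s0) (w + w) k (iarr s merged_arr) ->
  perm_eq (slice (iarr s merged_arr) 0 k) (slice (iarr s0 arr) 0 k) ->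
  runs open_blocks s 30
    (fun s' => merging_state s0 w k s' /\ k < ireg s' right_end_reg).
Proof.
move=> s_nodes s_width s_counter w_gt0 kn wk sortedB permB.
apply: runs_loopfree; rewrite //= s_nodes s_width s_counter -!minnE.
by split; [exists k; apply: merging_open|rewrite /=; lia].
Qed.

Lemma merge_choose_runs s0 w k s :
  rarr s key = rarr s0 key -> iarr s arr = iarr s0 arr -> ireg s counter_reg = k ->
  k < ireg s right_end_reg -> merging_state s0 w k s ->
  runs (merge_choose key arr) s 40 (merging_state s0 w k.+1).
Proof.
move=> s_key s_arr s_counter k_lt [start mg].
apply: runs_loopfree; rewrite //= s_key s_arr s_counter -!ltnNge.
have mg_k := merging_k mg; have mg_i := merging_i mg; have mg_j := merging_j mg.
split=> [/andP[lt_i]|]; rewrite negb_and negbK => le_key.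
  exists start; rewrite /= addn1; apply: merging_left => // lt_j.
  by move: le_key; rewrite lt_j.
exists start; rewrite /= addn1; apply: merging_right => //.
  by case/orP: le_key => [|/andP[]]; lia.
by move=> lt_i; move: le_key; rewrite lt_i /= => /andP[].
Qed.

Lemma merge_step_runs s0 w k s :
  0 < w -> sorted_blocks (key_le s0) w n (iarr s0 arr) ->
  rarr s key = rarr s0 key -> iarr s arr = iarr s0 arr -> ireg s nodes_reg = n ->
  ireg s width_reg = w -> ireg s counter_reg = k -> k < n -> merging_state s0 w k s ->
  runs (merge_step key arr) s 80 (merging_state s0 w k.+1).
Proof.
move=> w_gt0 sortedA s_key s_arr s_nodes s_width s_counter kn merging_s.
pose opened s' := merging_state s0 w k s' /\ k < ireg s' right_end_reg.
apply: (@runs_seq _ 34 opened) => // [|s' ag [merging_s' k_lt]].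
  apply: (@runs_if _ _ _ _ _ 30); rewrite /= s_counter => hi_k; last first.
    by apply: runs_loopfree => //; split=> //; rewrite ltnNge.
  have [start mg] := merging_s.
  have k_hi : k = ireg s right_end_reg.
    by have := merging_k mg; have := merging_i mg; have := merging_j mg; lia.
  move: mg; rewrite {1}k_hi => /merging_close-/(_ (key_le_total s0) sortedA).
  rewrite -k_hi => -[sortedB permB /(_ kn) wk].
  exact: open_blocks_runs.
apply: (runs_weaken (merge_choose_runs (s0 := s0) (w := w) (k := k) _ _ _ _ _)) => //.
- by rewrite (agree_off_rarr ag).
- by rewrite (agree_off_iarr ag).
- by rewrite (agree_off_ireg ag).
Qed.

Lemma merge_loop_runs s0 w s :
  0 < w -> sorted_blocks (key_le s0) w n (iarr s0 arr) ->
  rarr s key = rarr s0 key -> iarr s arr = iarr s0 arr -> ireg s nodes_reg = n ->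
  ireg s width_reg = w -> merging_state s0 w 0 s ->
  runs (For counter_reg nodes_reg (merge_step key arr)) s (n * 89 + 7)
    (merging_state s0 w n).
Proof.
move=> w_gt0 sortedA s_key s_arr s_nodes s_width merging_s.
apply: (runs_for _ _ _ s_nodes (I := merging_state s0 w) (B := 80)) => //.
move=> k s' kn ag s'_counter merging_s'.
apply: merge_step_runs => //.
- by rewrite (agree_off_rarr ag).
- by rewrite (agree_off_iarr ag) // !inE !arr_mergedF.
- by rewrite (agree_off_ireg ag).
- by rewrite (agree_off_ireg ag).
Qed.

Lemma copy_merged_runs s : ireg s nodes_reg = n ->
  runs (copy_merged arr) s (n * 13 + 7)
    (fun s' => forall i : 'I_n, iarr s' arr i = iarr s merged_arr i).
Proof.
move=> s_nodes; pose Q (i : 'I_n) s' := iarr s' arr i = iarr s merged_arr i.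
apply: (runs_foreach _ _ _ s_nodes (Q := Q)) => // i s' ag s'_counter.
rewrite /Q /= s'_counter eqxx /= eqxx.
rewrite (agree_off_iarr (a := merged_arr) ag); first by split=> // j /negPf->.
by rewrite !inE ![IArrAt merged_arr == IArrAt arr]eq_sym arr_mergedF.
Qed.

Lemma merge_blocks_runs w s :
  0 < w -> ireg s nodes_reg = n -> ireg s width_reg = w ->
  sorted_blocks (key_le s) w n (iarr s arr) ->
  runs (merge_blocks key arr) s (n * 160) (fun s' =>
    sorted_blocks (key_le s) (w + w) n (iarr s' arr) /\
    perm_eq (slice (iarr s' arr) 0 n) (slice (iarr s arr) 0 n)).
Proof.
move=> w_gt0 s_nodes s_width sortedA.
apply: runs_seq_loopfree => /=; first lia.
set s1 := set_ireg s counter_reg 0.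
have no_blocks : sorted_blocks (key_le s) (w + w) 0 (iarr s1 merged_arr).
  by move=> q; rewrite minn0 slice_nil.
apply: (runs_seq
  (open_blocks_runs (s := s1) s_nodes s_width _ w_gt0 n_gt0 _ no_blocks _)) => //=.
  by lia.
move=> s2 ag2 [mg2 _].
apply: (runs_seq (merge_loop_runs w_gt0 sortedA _ _ _ _ mg2)).
all: rewrite ?(agree_off_rarr ag2) ?(agree_off_iarr ag2) ?(agree_off_ireg ag2) //.
  by lia.
move=> s3 ag3 [start mg3].
have end3 : ireg s3 right_end_reg = n.
  have := merging_k mg3; have := merging_i mg3; have := merging_j mg3.
  by have := merging_hi mg3; lia.
move: mg3; rewrite end3 => /merging_close-/(_ (key_le_total s) sortedA).
move=> [sortedB permB _].
apply: (runs_weaken (copy_merged_runs (s := s3) _)).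
- by rewrite (agree_off_ireg ag3) // (agree_off_ireg ag2).
- by lia.
move=> s4 _ copied.
have copied_slice i j : j <= n ->
    slice (iarr s4 arr) i j = slice (iarr s3 merged_arr) i j.
  move=> jn; apply: eq_slice => x ?; have xn : x < n by lia.
  exact: (copied (Ordinal xn)).
by split=> [q|]; rewrite copied_slice // geq_minr.
Qed.

Lemma list_nodes_runs s : ireg s nodes_reg = n ->
  runs (list_nodes arr) s (n * 12 + 7) (fun s' => forall i : 'I_n, iarr s' arr i = i).
Proof.
move=> s_nodes; pose Q (i : 'I_n) s' := iarr s' arr i = i.
apply: (runs_foreach _ _ _ s_nodes (Q := Q)) => // i s' _ s'_counter.
by rewrite /Q /= s'_counter eqxx /= eqxx; split=> // j /negPf->.
Qed.

Lemma merge_sort_runs s : ireg s nodes_reg = n ->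
  runs (merge_sort key arr) s (200 * (n * (trunc_log 2 n).+1)) (fun s' =>
    sorts (rarr s key) n (iarr s' arr)).
Proof.
move=> s_nodes; apply: (runs_seq (list_nodes_runs s_nodes)) => [|s1 ag1 id1]; first lia.
pose I w s' := [/\ 0 < w, sorted_blocks (key_le s) w n (iarr s' arr)
  & perm_eq (slice (iarr s' arr) 0 n) (iota 0 n)].
apply: (runs_weaken
  (runs_doubling (n := n) _ _ _ _ (I := I) (B := n * 160) _ _ _)) => //.
- by rewrite (agree_off_ireg ag1).
- split=> // [q|]; last first.
    rewrite (eq_slice (g := id)) => [|x xn]; last exact: (id1 (Ordinal xn)).
    by rewrite /slice map_id /index_iota subn0.
  have: size (slice (iarr s1 arr) (q * 1) (minn (q * 1 + 1) n)) <= 1.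
    by rewrite size_slice; lia.
  by case: slice => [|? []].
- move=> w s2 w_n ag2 s2_width [w_gt0 sorted2 perm2].
  have ag12 := agree_off_cat ag1 ag2.
  have s2_nodes : ireg s2 nodes_reg = n by rewrite (agree_off_ireg ag12).
  have s2_key : key_le s2 = key_le s by rewrite /key_le (agree_off_rarr ag12).
  apply: (runs_weaken (merge_blocks_runs w_gt0 s2_nodes s2_width _));
    rewrite ?s2_key //.
  move=> s3 _ [sorted3 perm3]; split=> //; first by lia.
  exact: perm_trans perm3 perm2.
- have : trunc_log 2 n <= n * trunc_log 2 n by rewrite leq_pmull.
  by rewrite /=; lia.
- move=> s2 _ [w nw [w_gt0 sorted2 perm2]]; split=> //.
  by have := sorted2 0; rewrite mul0n add0n (minn_idPr nw).
Qed.

End MergeSort.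

(** * Preprocessing *)

(* The ancestor of every node is replaced by its own ancestor until it is the
   root; the depth array holds the distance to the ancestor. *)
Definition jump : cmd :=
  RPut depth_arr counter
    (RAdd (RGet depth_arr counter)
          (RGet depth_arr (IGet ancestor_arr counter))) ;;
  IPut ancestor_arr counter
    (IGet ancestor_arr (IGet ancestor_arr counter)).

Definition start_at_parents : cmd :=
  For counter_reg nodes_reg
    (IPut ancestor_arr counter (IGet parent_arr counter) ;;
     If (ILe (ICst 1) counter)
       (RPut depth_arr counter (RCst 1))
       (RPut depth_arr counter (RCst 0))).

Definition compute_depths : cmd :=
  start_at_parents ;;
  Doubling width_reg nodes_reg (For counter_reg nodes_reg jump).

Definition mark_path : cmd :=
  ISet node_reg (IReg target_reg) ;;
  While (ILe (ICst 1) node)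
    (IPut on_path_arr node (ICst 1) ;;
     ISet node_reg (IGet parent_arr node)).

Definition mark_inner : cmd :=
  For counter_reg nodes_reg
    (If (ILe (ICst 1) counter)
       (IPut inner_arr (IGet parent_arr counter) (ICst 1)) Skip).

Section Preprocessing.
Variables (R : realType) (m : nat) (par : 'I_m -> 'I_m.+1).
Hypothesis rooted : rooted_tree par.
Implicit Types (s : state R) (v : 'I_m.+1).

Definition parent_entry : nat -> nat := edge_array 0 (fun e => nat_of_ord (par e)).

Lemma parent_entry_child e : parent_entry (child e) = par e.
Proof. exact: edge_array_child. Qed.

Lemma parent_entryE v : parent_entry v = parent par v.
Proof.
case: (nodeP v) => [|e]; first by rewrite parent_root.
by rewrite parent_entry_child parent_child.
Qed.

Lemma depth_parent v : depth par (parent par v) = (depth par v).-1.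
Proof.
case: (nodeP v) => [|e]; first by rewrite parent_root depth_root.
by rewrite parent_child (depth_child rooted).
Qed.

Definition jumped (w : nat) s v : Prop :=
  exists a : 'I_m.+1, [/\ iarr s ancestor_arr v = a :> nat,
      depth par a <= depth par v - w
    & rarr s depth_arr v = ((depth par v)%:R - (depth par a)%:R)%R].

Lemma jumped_le w w' s v : w <= w' -> jumped w' s v -> jumped w s v.
Proof. by move=> ww' [a [sa da ra]]; exists a; split=> //; lia. Qed.

Lemma start_at_parents_runs s :
  ireg s nodes_reg = m.+1 -> iarr s parent_arr = parent_entry ->
  runs start_at_parents s (m.+1 * 30) (fun s' => forall v, jumped 1 s' v).
Proof.
move=> s_nodes s_parent; pose Q v s' := jumped 1 s' v.
apply: (runs_weaken (runs_foreach _ _ _ s_nodes (Q := Q) _ _)) =>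
  // [v s' ag s'_counter|/=]; last lia.
rewrite /= s'_counter (agree_off_iarr ag) // s_parent parent_entryE.
have others x y (v' : 'I_m.+1) : v' != v :> nat -> Q v' s' ->
    Q v' (set_rarr (set_iarr s' ancestor_arr v x) depth_arr v y).
  by move=> /negPf v'v [a [sa da ra]]; exists a; rewrite /= v'v.
split=> v_root; (split; last exact: others); exists (parent par v);
  rewrite /= eqxx depth_parent; split=> //; try lia.
- by move: v_root; case: (nodeP v) => // e _; rewrite depth_child //= -natrB // subSnn.
- by move: v_root; case: (nodeP v) => // _; rewrite depth_root subrr.
Qed.

Lemma jump_runs w s v : ireg s counter_reg = v -> (forall x, jumped w s x) ->
  runs jump s 16 (fun s' => jumped (w + w) s' v /\
    forall x w', x != v -> jumped w' s x -> jumped w' s' x).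
Proof.
move=> sv jumped_s; apply: runs_loopfree => //=; rewrite sv; split.
  have [a [sa da ra]] := jumped_s v; have [b [sb db rb]] := jumped_s a.
  exists b; rewrite /= eqxx sa sb ra rb addrA subrK; split=> //; lia.
by move=> x w' xv [a [sa da ra]]; exists a; rewrite /= !ifN.
Qed.

Lemma jump_loop_runs w s : ireg s nodes_reg = m.+1 -> (forall v, jumped w s v) ->
  runs (For counter_reg nodes_reg jump) s (m.+1 * 32)
    (fun s' => forall v, jumped (w + w) s' v).
Proof.
move=> s_nodes jumped_s.
pose I k s' := forall v, jumped (if v < k then w + w else w) s' v.
apply: (runs_weaken (runs_for _ _ _ s_nodes (I := I) (B := 16) _ _ _)) => //.
- move=> k s1 k_n ag s1_counter I1; pose v := Ordinal k_n.
  have jumped1 x : jumped w s1 x by apply: jumped_le (I1 x); case: ifP; lia.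
  apply: (runs_weaken (jump_runs (v := v) s1_counter jumped1)) => //.
  move=> s2 _ [new others] x.
  have [->|xv] := eqVneq x v; first by rewrite /= ltnSn.
  have -> : (x < k.+1) = (x < k); last exact: others.
  by move: xv; rewrite ltnS leq_eqVlt -(inj_eq val_inj) => /negPf /= ->.
- by lia.
- by move=> s1 _ I1 v; have := I1 v; rewrite ltn_ord.
Qed.

Lemma compute_depths_runs s :
  ireg s nodes_reg = m.+1 -> iarr s parent_arr = parent_entry ->
  runs compute_depths s (100 * (m.+1 * (trunc_log 2 m.+1).+1))
    (fun s' => forall v, rarr s' depth_arr v = (depth par v)%:R%R).
Proof.
move=> s_nodes s_parent.
apply: (runs_seq (start_at_parents_runs s_nodes s_parent)); first lia.
move=> s1 ag1 jumped1.
pose I w s' := forall v, jumped w s' v.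
apply: (runs_weaken
  (runs_doubling (n := m.+1) _ _ _ _ (I := I) (B := m.+1 * 32) _ _ _)) => //.
- by rewrite (agree_off_ireg ag1).
- move=> w s2 _ ag2 _; apply: jump_loop_runs.
  by rewrite (agree_off_ireg ag2) // (agree_off_ireg ag1).
- have : trunc_log 2 m.+1 <= m.+1 * trunc_log 2 m.+1 by rewrite leq_pmull.
  by rewrite /=; lia.
- move=> s2 _ [w n_w jumped2] v; have [a [_ da ->]] := jumped2 v.
  have -> : depth par a = 0 by have := depth_lt par v; lia.
  by rewrite subr0.
Qed.

Lemma mark_path_runs s (t : 'I_m.+1) :
  ireg s target_reg = t -> iarr s parent_arr = parent_entry ->
  (forall e : 'I_m, iarr s on_path_arr (child e) = 0) ->
  runs mark_path s (m.+1 * 20) (fun s' => forall e : 'I_m,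
    (0 < iarr s' on_path_arr (child e)) = (e \in root_path par t)).
Proof.
move=> s_target s_parent unmarked; apply: runs_seq_loopfree => /=; first lia.
set s0 := set_ireg s _ _; pose I k s' := exists v, [/\ ireg s' node_reg = v,
  depth par v <= k & forall e : 'I_m, (0 < iarr s' on_path_arr (child e)) ||
    (e \in root_path par v) = (e \in root_path par t)].
have I0 : I (depth par t) s0.
  by exists t; rewrite /= s_target; split=> // e; rewrite unmarked.
apply: (runs_weaken (runs_while (I := I) (B := 7) _ I0)) => [k s1 ag|/=|s1 _].
- move=> [v [s1_node]]; rewrite /= s1_node; case: (nodeP v) s1_node => // e s1_node.
  rewrite (depth_child rooted) => depth_k marked _; exists k.-1; first by lia.
  apply: runs_loopfree => //=; exists (par e).
  rewrite s1_node (agree_off_iarr ag) //= s_parent parent_entry_child.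
  split=> // [|e']; first by lia.
  rewrite -marked root_path_child in_setU1 child_eqE.
  by case: eqVneq; rewrite //= orbT.
- by have := depth_lt par t; lia.
- move=> [guard [_ [v [s1_node _ marked]]]] e; rewrite -marked.
  move: guard; rewrite /= s1_node; case: (nodeP v) => // _.
  by rewrite root_path_root in_set0 orbF.
Qed.

Lemma mark_inner_runs s :
  ireg s nodes_reg = m.+1 -> iarr s parent_arr = parent_entry ->
  (forall v, iarr s inner_arr v = 0) ->
  runs mark_inner s (m.+1 * 30) (fun s' => forall v,
    iarr s' inner_arr v = 0 <-> leaf par v).
Proof.
move=> s_nodes s_parent unmarked.
pose I k s' := forall v,
  (0 < iarr s' inner_arr v) = [exists e, (child e < k) && (par e == v)].
apply: (runs_weaken (runs_for _ _ _ s_nodes (I := I) (B := 12) _ _ _)) => //.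
- by move=> v; rewrite unmarked; apply/esym/existsP => -[e].
- move=> k s1 k_n ag s1_counter I1; apply: runs_loopfree => //=.
  rewrite s1_counter (agree_off_iarr ag) //= s_parent.
  have earlier (e e' : 'I_m) :
      (child e < (child e').+1) = (e == e') || (child e < child e').
    by rewrite ltnS leq_eqVlt child_eqE.
  have [x kx] : exists x : 'I_m.+1, k = x by exists (Ordinal k_n).
  move: I1; rewrite kx; case: (nodeP x) => [|e] I1; split=> // _ v.
  rewrite parent_entry_child [iarr _ _ _]/= val_eqE.
  have [->|par_v] := eqVneq v (par e).
    by apply/esym/existsP; exists e; rewrite earlier !eqxx.
  rewrite I1; apply: eq_existsb => e'; rewrite earlier; have [->|//] := eqVneq e' e.
  by rewrite [par e == v]eq_sym (negPf par_v) !andbF.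
- by lia.
- move=> s1 _ I1 v; split=> [v0 e ev|leaf_v].
    have := I1 v; rewrite v0 => /esym/existsP[]; exists e.
    by rewrite ev eqxx ltn_ord.
  apply/eqP; rewrite -leqn0 leqNgt I1; apply/existsP => -[e /andP[_ /eqP]].
  exact: leaf_v.
Qed.

End Preprocessing.

(** * Binary search *)

Definition binary_search_step (p : cmd) : cmd :=
  ISet mid_reg (IHalf (IAdd (IReg low_reg) (IReg high_reg))) ;;
  p ;;
  If (ILe (ICst 1) (IReg passed_reg))
    (ISet high_reg (IReg mid_reg)) (ISet low_reg (IAdd (IReg mid_reg) (ICst 1))).

Definition binary_search (p : cmd) : cmd :=
  ISet low_reg (ICst 0) ;;
  ISet high_reg (IReg nodes_reg) ;;
  While (ILt (IReg low_reg) (IReg high_reg)) (binary_search_step p).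

Definition least_index (passes : nat -> Prop) (n k : nat) : Prop :=
  [/\ k <= n, forall j, j < k -> ~ passes j & k < n -> passes k].

Section BinarySearch.
Variables (R : realType) (passes : nat -> Prop) (p : cmd) (B n : nat) (s : state R).
Hypotheses (s_nodes : ireg s nodes_reg = n)
  (passes_mono : forall j k, j <= k -> k < n -> passes j -> passes k)
  (p_free : all (fun x => x \notin writes p)
     [:: IRegAt low_reg; IRegAt high_reg; IRegAt mid_reg])
  (p_runs : forall s1 : state R, agree_off (writes (binary_search p)) s s1 ->
     ireg s1 mid_reg < n ->
     runs p s1 B (fun s2 => 0 < ireg s2 passed_reg <-> passes (ireg s1 mid_reg))).

Definition enclosing (k : nat) (s1 : state R) : Prop :=
  [/\ ireg s1 high_reg < ireg s1 low_reg + 2 ^ k,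
      ireg s1 low_reg <= ireg s1 high_reg <= n,
      forall j, j < ireg s1 low_reg -> ~ passes j
    & ireg s1 high_reg < n -> passes (ireg s1 high_reg)].

Lemma binary_search_step_runs k s1 :
  agree_off (writes (binary_search p)) s s1 -> enclosing k.+1 s1 ->
  ireg s1 low_reg < ireg s1 high_reg ->
  runs (binary_search_step p) s1 (B + 20) (enclosing k).
Proof.
move: p_free => /and4P[p_low p_high p_mid _] ag [width bounds fail pass] lt_high.
apply: runs_seq_loopfree => /=; first lia.
set mid := (_ + _)./2; set s2 := set_ireg _ _ _.
have mid_bounds : ireg s1 low_reg <= mid < ireg s1 high_reg by rewrite /mid; lia.
have ag2 : agree_off (writes (binary_search p)) s s2.
  by apply: agree_off_trans ag (agree_off_set_ireg _ _ _); rewrite !inE eqxx !orbT.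
apply: (runs_seq (p_runs ag2 _)) => [|/=|s3 ag3 /= passed]; rewrite /= ?eqxx;
  [lia|lia|].
apply: runs_loopfree => /=; first lia.
rewrite /enclosing /= (agree_off_ireg ag3 p_low) (agree_off_ireg ag3 p_high)
  (agree_off_ireg ag3 p_mid) /=.
rewrite expnS in width; split=> [/passed pass_mid|fail_mid]; split=> //; try lia.
move=> j j_mid pass_j; move/negP: fail_mid; apply; apply/passed.
by apply: passes_mono pass_j; lia.
Qed.

Lemma binary_search_runs :
  runs (binary_search p) s ((trunc_log 2 n).+1 * (B + 25) + 10)
    (fun s' => least_index passes n (ireg s' low_reg)).
Proof.
do 2! [apply: runs_seq_loopfree => /=; first lia].
set s0 := set_ireg _ _ _.
have I0 : enclosing (trunc_log 2 n).+1 s0.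
  rewrite /enclosing /= s_nodes; split=> //; last by lia.
  exact: trunc_log_ltn.
have ag0 : agree_off (writes (binary_search p)) s s0.
  by do 2! [apply: agree_off_trans; last by
    apply: agree_off_set_ireg; rewrite !inE eqxx ?orbT].
have ag_search s1 : agree_off (writes (binary_search_step p)) s0 s1 ->
    agree_off (writes (binary_search p)) s s1.
  move=> ag; apply: agree_off_trans ag0 (agree_off_sub _ ag) => x step_x.
  exact/mem_behead/mem_behead.
apply: (runs_weaken (runs_while (I := enclosing) (B := B + 20) _ I0)) =>
  [k s1 ag I1|/=|s1 _].
- rewrite /= -ltnNge => low_high; case: k I1 => [|k] I1; first by case: I1; lia.
  by exists k => //; apply: binary_search_step_runs => //; apply: ag_search.
- by lia.
- move=> [guard [k [_ bounds fail pass]]].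
  have high_low : ireg s1 high_reg = ireg s1 low_reg.
    by move: guard; rewrite /= negbK; lia.
  by split=> //; [lia|rewrite -high_low].
Qed.

End BinarySearch.

(** * Testing a threshold *)

Definition relax_bounds : cmd :=
  For counter_reg nodes_reg
    (If (RLe (RGet cost_arr counter) (RReg threshold_reg))
       (RPut lower_arr counter (RGet l_arr counter) ;;
        RPut upper_arr counter (RGet u_arr counter))
       (RPut lower_arr counter (RGet w_arr counter) ;;
        RPut upper_arr counter (RGet w_arr counter))).

Definition path_weights_step (src dst : nat) : cmd :=
  ISet node_reg (IGet by_depth_arr counter) ;;
  If (ILe (ICst 1) node)
    (RPut dst node
       (RAdd (RGet src node) (RGet dst (IGet parent_arr node))))
    Skip.

Definition path_weights (src dst : nat) : cmd :=
  RPut dst (ICst 0) (RCst 0) ;;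
  For counter_reg nodes_reg (path_weights_step src dst).

Definition cap_dists : cmd :=
  let bound := RAdd (RGet least_dist_arr counter)
                 (RSub (RReg total_reg) (RGet least_dist_arr (IReg target_reg))) in
  For counter_reg nodes_reg
    (If (RLe (RGet greatest_dist_arr counter) bound)
       (RPut capped_dist_arr counter (RGet greatest_dist_arr counter))
       (RPut capped_dist_arr counter bound)).

Definition assign_weights : cmd :=
  For counter_reg nodes_reg
    (If (ILe (ICst 1) (IGet on_path_arr counter))
       (RPut solution_arr counter
          (RSub (RGet capped_dist_arr counter)
                (RGet capped_dist_arr (IGet parent_arr counter))))
       (RPut solution_arr counter (RGet upper_arr counter))).

Definition check_target : cmd :=
  If (BAnd (RLe (RGet least_dist_arr (IReg target_reg)) (RReg total_reg))
           (RLe (RReg total_reg) (RGet greatest_dist_arr (IReg target_reg))))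
    (ISet passed_reg (ICst 1)) (ISet passed_reg (ICst 0)).

Definition check_leaves : cmd :=
  For counter_reg nodes_reg
    (If (BAnd (ILe (IGet inner_arr counter) (ICst 0))
              (BNot (RLe (RReg total_reg) (RGet dist_arr counter))))
       (ISet passed_reg (ICst 0)) Skip).

Definition solve : cmd :=
  relax_bounds ;;
  path_weights lower_arr least_dist_arr ;;
  path_weights upper_arr greatest_dist_arr ;;
  cap_dists ;;
  assign_weights ;;
  path_weights solution_arr dist_arr.

Definition test : cmd := solve ;; check_target ;; check_leaves.

Definition test_threshold (k : nat) : cmd :=
  RSet threshold_reg (RGet cost_arr (IGet by_cost_arr (IReg k))) ;; test.

Definition search : cmd := binary_search (test_threshold mid_reg).

Definition report : cmd :=
  If (ILe (IReg nodes_reg) (IReg low_reg))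
    (ISet verdict_reg (ICst 0))
    (test_threshold low_reg ;;
     RSet value_reg (RReg threshold_reg) ;;
     ISet verdict_reg (ICst 1)).

Section Solver.
Variables (R : realType) (m : nat) (par : 'I_m -> 'I_m.+1) (t0 : 'I_m.+1).
Variables (l w u c : 'I_m -> R) (D : R).
Hypotheses (rooted : rooted_tree par) (lwu : forall e, (l e <= w e <= u e)%R)
  (c_gt0 : forall e, (0 < c e)%R).
Implicit Types s : state R.

Record prepared s : Prop := Prepared {
  prepared_nodes : ireg s nodes_reg = m.+1;
  prepared_target : ireg s target_reg = t0;
  prepared_total : rreg s total_reg = D;
  prepared_parent : iarr s parent_arr = parent_entry par;
  prepared_l : rarr s l_arr = edge_array 0%R l;
  prepared_w : rarr s w_arr = edge_array 0%R w;
  prepared_u : rarr s u_arr = edge_array 0%R u;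
  prepared_cost : rarr s cost_arr = threshold c;
  prepared_depth : forall v : 'I_m.+1, rarr s depth_arr v = (depth par v)%:R%R;
  prepared_by_depth : sorts (rarr s depth_arr) m.+1 (iarr s by_depth_arr);
  prepared_by_cost : sorts (threshold c) m.+1 (iarr s by_cost_arr);
  prepared_on_path : forall e : 'I_m,
    (0 < iarr s on_path_arr (child e)) = (e \in root_path par t0);
  prepared_inner : forall v : 'I_m.+1, iarr s inner_arr v = 0 <-> leaf par v }.

Definition prepared_locations : seq location :=
  [:: IRegAt nodes_reg; IRegAt target_reg; RRegAt total_reg; IArrAt parent_arr;
      RArrAt l_arr; RArrAt w_arr; RArrAt u_arr; RArrAt cost_arr; RArrAt depth_arr;
      IArrAt by_depth_arr; IArrAt by_cost_arr; IArrAt on_path_arr; IArrAt inner_arr].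

Lemma prepared_agree_off W s s' :
  agree_off W s s' -> all (fun x => x \notin prepared_locations) W ->
  prepared s -> prepared s'.
Proof.
move=> ag /allP W_free.
have same x : x \in prepared_locations -> content s' x = content s x.
  by move=> x_prep; apply: ag; apply: contraL x_prep => /W_free.
have same_ireg i : IRegAt i \in prepared_locations -> ireg s' i = ireg s i.
  exact: same.
have same_rreg i : RRegAt i \in prepared_locations -> rreg s' i = rreg s i.
  exact: same.
have same_iarr a : IArrAt a \in prepared_locations -> iarr s' a = iarr s a.
  exact: same.
have same_rarr a : RArrAt a \in prepared_locations -> rarr s' a = rarr s a.
  exact: same.
by case=> *; split; rewrite ?same_ireg ?same_rreg ?same_iarr ?same_rarr.
Qed.

Local Notation dist f v := (weight f (root_path par v)).

Lemma relax_bounds_runs s : prepared s ->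
  runs relax_bounds s (m.+1 * 40) (fun s' => forall e : 'I_m,
    rarr s' lower_arr (child e) = relax w c (rreg s threshold_reg) l e /\
    rarr s' upper_arr (child e) = relax w c (rreg s threshold_reg) u e).
Proof.
move=> ps; set C := rreg s threshold_reg.
pose bound (b : nat -> R) i :=
  if (threshold c i <= C)%R then b i else edge_array 0%R w i.
pose Q (i : 'I_m.+1) s' := rarr s' lower_arr i = bound (edge_array 0%R l) i /\
                           rarr s' upper_arr i = bound (edge_array 0%R u) i.
apply: (runs_weaken (runs_foreach _ _ _ (prepared_nodes ps) (Q := Q) _ _)) => //.
- move=> i s' ag s'_counter; have ps' := prepared_agree_off ag isT ps.
  rewrite /= s'_counter (prepared_cost ps') (prepared_l ps') (prepared_w ps').
  rewrite (prepared_u ps') (agree_off_rreg ag) // /Q /bound.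
  by split=> ciC; rewrite /= eqxx; (split=> [|j /negPf->//]); rewrite ?ciC ?(negPf ciC).
- by rewrite /=; lia.
- move=> s' _ relaxed e; have := relaxed (child e).
  by rewrite /Q /bound /threshold !edge_array_child.
Qed.

Section PathWeights.
Variables (src dst : nat) (f : 'I_m -> R).
Hypotheses (neq_src_dst : src != dst) (dst_free : RArrAt dst \notin prepared_locations).

Let src_dstF : (RArrAt src == RArrAt dst) = false.
Proof. exact: negPf neq_src_dst. Qed.

Definition weighed (k : nat) s : Prop :=
  rarr s dst 0 = 0%R /\ forall j (v : 'I_m.+1), j < k ->
    iarr s by_depth_arr j = v -> rarr s dst v = dist f v.

Lemma path_weights_step_runs s k : prepared s ->
  (forall e : 'I_m, rarr s src (child e) = f e) -> k < m.+1 ->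
  ireg s counter_reg = k -> weighed k s ->
  runs (path_weights_step src dst) s 20 (weighed k.+1).
Proof.
move=> ps s_src k_n s_counter [s_dst0 weighed_k].
apply: runs_loopfree => //=; rewrite s_counter.
have order_lt := sorts_lt (prepared_by_depth ps) k_n.
have [v at_k] : exists v : 'I_m.+1, iarr s by_depth_arr k = v.
  by exists (Ordinal order_lt).
rewrite at_k (prepared_parent ps); case: (nodeP v) at_k => [|e] at_k; split=> // _.
  split=> // j v' jk at_j; have [jk'|] := ltnP j k; first exact: weighed_k at_j.
  move=> kj; have jk_eq : j = k by lia.
  have -> : v' = ord0 by apply: val_inj; rewrite /= -at_j jk_eq at_k.
  by rewrite weight_root.
have [i ik at_i] : exists2 i, i < k & iarr s by_depth_arr i = par e.
  apply: (sorts_lt_index (prepared_by_depth ps)) => //.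
  by rewrite at_k !(prepared_depth ps) ltr_nat depth_child.
have new_e : (f e + rarr s dst (par e) = dist f (child e))%R.
  by rewrite weight_child // (weighed_k _ _ ik at_i).
rewrite s_src parent_entry_child new_e; split=> [|j v' jk at_j] /=; rewrite eqxx.
  exact: s_dst0.
have [->|] := eqVneq v' (child e); first by rewrite /= eqxx.
rewrite -val_eqE /= => v'e; rewrite (negPf v'e); apply: (weighed_k j) => //.
suff : j != k by lia.
by apply: contra v'e => /eqP jk_eq; rewrite -at_j jk_eq at_k.
Qed.

Lemma path_weights_runs s : prepared s ->
  (forall e : 'I_m, rarr s src (child e) = f e) ->
  runs (path_weights src dst) s (m.+1 * 50) (fun s' => forall v : 'I_m.+1,
    rarr s' dst v = dist f v).
Proof.
move=> ps s_src; apply: runs_seq_loopfree => /=; first lia.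
set s0 := set_rarr _ _ _ _.
have ag0 : agree_off [:: RArrAt dst] s s0.
  exact: exec_agree_off (ExRPut s dst (ICst 0) (RCst 0)).
have ps0 : prepared s0 by apply: prepared_agree_off ag0 _ ps; rewrite /= dst_free.
have s0_src e : rarr s0 src (child e) = f e.
  by rewrite (agree_off_rarr ag0) ?inE ?src_dstF.
apply: (runs_weaken
  (runs_for _ _ _ (prepared_nodes ps0) (I := weighed) (B := 20) _ _ _)) => //.
- by rewrite /weighed /= !eqxx.
- move=> k s1 k_n ag1 s1_counter weighed1.
  apply: path_weights_step_runs => //.
    by apply: prepared_agree_off ag1 _ ps0; rewrite /= dst_free.
  by move=> e; rewrite (agree_off_rarr ag1) // !inE src_dstF.
- by lia.
- move=> s1 ag1 [_ weighed1] v.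
  have [j jn at_j] := sorts_surj (prepared_by_depth ps0) (ltn_ord v).
  by apply: (weighed1 j v jn); rewrite (agree_off_iarr ag1).
Qed.

End PathWeights.

Section Weights.
Variables lo hi : 'I_m -> R.

Lemma cap_dists_runs s : prepared s ->
  (forall v : 'I_m.+1, rarr s least_dist_arr v = dist lo v) ->
  (forall v : 'I_m.+1, rarr s greatest_dist_arr v = dist hi v) ->
  runs cap_dists s (m.+1 * 50) (fun s' => forall v : 'I_m.+1,
    rarr s' capped_dist_arr v = capped_dist par t0 lo hi D v).
Proof.
move=> ps s_lo s_hi.
pose Q (v : 'I_m.+1) s' := rarr s' capped_dist_arr v = capped_dist par t0 lo hi D v.
apply: (runs_weaken (runs_foreach _ _ _ (prepared_nodes ps) (Q := Q) _ _)) =>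
  // [v s' ag s'_counter|/=].
  have ps' := prepared_agree_off ag isT ps.
  rewrite /= s'_counter (prepared_total ps') (prepared_target ps').
  rewrite !(agree_off_rarr ag) //.
  rewrite s_hi !s_lo /Q /=; split=> cap_v; rewrite eqxx; (split=> [|v' /negPf->//]).
    by rewrite /capped_dist min_l.
  by rewrite /capped_dist min_r // ltW // ltNge.
by lia.
Qed.

Lemma assign_weights_runs s : prepared s ->
  (forall v : 'I_m.+1, rarr s capped_dist_arr v = capped_dist par t0 lo hi D v) ->
  (forall e : 'I_m, rarr s upper_arr (child e) = hi e) ->
  runs assign_weights s (m.+1 * 50) (fun s' => forall e : 'I_m,
    rarr s' solution_arr (child e) = greatest_weight par t0 lo hi D e).
Proof.
move=> ps s_capped s_hi.
pose Q (v : 'I_m.+1) s' := forall e : 'I_m, v = child e ->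
  rarr s' solution_arr v = greatest_weight par t0 lo hi D e.
apply: (runs_weaken (runs_foreach _ _ _ (prepared_nodes ps) (Q := Q) _ _)) => //.
- move=> v s' ag s'_counter; have ps' := prepared_agree_off ag isT ps.
  rewrite /= s'_counter (prepared_parent ps') !(agree_off_rarr ag) // /Q /=.
  split=> on_path; (split=> [e v_e|v' /negPf->//]); move: on_path;
    rewrite eqxx v_e (prepared_on_path ps') /greatest_weight.
  + by move=> ->; rewrite parent_entry_child !s_capped.
  + by move/negPf->.
- by rewrite /=; lia.
- by move=> s' _ assigned e; apply: assigned.
Qed.

Lemma check_target_runs s : prepared s ->
  (forall v : 'I_m.+1, rarr s least_dist_arr v = dist lo v) ->
  (forall v : 'I_m.+1, rarr s greatest_dist_arr v = dist hi v) ->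
  runs check_target s 20 (fun s' =>
    0 < ireg s' passed_reg <-> (dist lo t0 <= D <= dist hi t0)%R).
Proof.
move=> ps s_lo s_hi; apply: runs_loopfree => //=.
rewrite (prepared_target ps) (prepared_total ps) s_lo s_hi.
by split=> [->|/negPf->].
Qed.

Lemma check_leaves_runs s (f : 'I_m -> R) : prepared s ->
  (forall v : 'I_m.+1, rarr s dist_arr v = dist f v) ->
  runs check_leaves s (m.+1 * 40) (fun s' => 0 < ireg s' passed_reg <->
    0 < ireg s passed_reg /\ forall t, leaf par t -> (D <= dist f t)%R).
Proof.
move=> ps s_dist.
pose I k s' := 0 < ireg s' passed_reg <-> 0 < ireg s passed_reg /\
  forall t : 'I_m.+1, t < k -> leaf par t -> (D <= dist f t)%R.
apply: (runs_weaken
  (runs_for _ _ _ (prepared_nodes ps) (I := I) (B := 16) _ _ _)) => //.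
- by split=> // -[].
- move=> k s1 k_n ag s1_counter Ik; have ps1 := prepared_agree_off ag isT ps.
  apply: runs_loopfree => //=.
  rewrite s1_counter (prepared_total ps1) (agree_off_rarr ag) //.
  have [v kv] : exists v : 'I_m.+1, k = v by exists (Ordinal k_n).
  rewrite kv leqn0 s_dist; split=> [/andP[/eqP inner_v D_v]|].
    split=> // -[_ /(_ v (ltnSn _))]; rewrite (negPf D_v).
    by move/(_ ((prepared_inner ps1 v).1 inner_v)).
  move=> checked; split=> [/Ik[sp leaves]|[sp leaves]]; last first.
    by apply/Ik; split=> // t tk; apply: leaves; lia.
  split=> // t tk leaf_t; have [tv|] := eqVneq t v; last first.
    by rewrite -val_eqE /= => tv; apply: leaves => //; lia.
  move: checked; rewrite negb_and negbK tv => /orP[/eqP[]|//].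
  by apply/(prepared_inner ps1); rewrite -tv.
- by lia.
- move=> s1 _ Ik; split=> [/Ik[sp leaves]|[sp leaves]].
    by split=> // t; apply: leaves.
  by apply/Ik; split=> // t _; apply: leaves.
Qed.

End Weights.

Definition solved (C : R) s : Prop :=
  let lo := relax w c C l in let hi := relax w c C u in
  [/\ forall v : 'I_m.+1, rarr s least_dist_arr v = dist lo v,
      forall v : 'I_m.+1, rarr s greatest_dist_arr v = dist hi v,
      forall e : 'I_m, rarr s solution_arr (child e) = greatest_weight par t0 lo hi D e
    & forall v : 'I_m.+1, rarr s dist_arr v = dist (greatest_weight par t0 lo hi D) v].

Lemma solve_runs s : prepared s ->
  runs solve s (m.+1 * 300) (solved (rreg s threshold_reg)).
Proof.
move=> ps; set C := rreg s threshold_reg.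
apply: (runs_seq (relax_bounds_runs ps)) => [|s1 ag1 relaxed]; first lia.
have lower1 e : rarr s1 lower_arr (child e) = relax w c C l e by case: (relaxed e).
have upper1 e : rarr s1 upper_arr (child e) = relax w c C u e by case: (relaxed e).
have ps1 := prepared_agree_off ag1 isT ps.
apply: (runs_seq (path_weights_runs (dst := least_dist_arr) _ _ ps1 lower1)) =>
  // [|s2 ag2 least2]; first lia.
have ps2 := prepared_agree_off ag2 isT ps1.
have upper2 e : rarr s2 upper_arr (child e) = relax w c C u e.
  by rewrite (agree_off_rarr ag2) ?upper1.
apply: (runs_seq (path_weights_runs (dst := greatest_dist_arr) _ _ ps2 upper2)) =>
  // [|s3 ag3 greatest3]; first lia.
have ps3 := prepared_agree_off ag3 isT ps2.
have least3 (v : 'I_m.+1) : rarr s3 least_dist_arr v = dist (relax w c C l) v.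
  by rewrite (agree_off_rarr ag3) ?least2.
apply: (runs_seq (cap_dists_runs ps3 least3 greatest3)); first lia.
move=> s4 ag4 capped4.
have ps4 := prepared_agree_off ag4 isT ps3.
have upper4 e : rarr s4 upper_arr (child e) = relax w c C u e.
  by rewrite (agree_off_rarr ag4) // (agree_off_rarr ag3) // upper2.
apply: (runs_seq (assign_weights_runs ps4 capped4 upper4)); first lia.
move=> s5 ag5 solution5.
have ps5 := prepared_agree_off ag5 isT ps4.
apply: (runs_weaken (path_weights_runs (dst := dist_arr) _ _ ps5 solution5)) =>
  // [|s6 ag6 dist6]; first lia.
split=> // [v|v|e]; rewrite (agree_off_rarr ag6) ?solution5 // (agree_off_rarr ag5) //
  (agree_off_rarr ag4) //.
Qed.

Lemma test_runs s : prepared s ->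
  runs test s (m.+1 * 400) (fun s' =>
    let C := rreg s threshold_reg in
    (fun e : 'I_m => rarr s' solution_arr (child e)) =
      cheapest_solution par t0 l w u c D C /\
    (0 < ireg s' passed_reg <->
      solvable_bounds par t0 (relax w c C l) (relax w c C u) D)).
Proof.
move=> ps; set C := rreg s threshold_reg.
apply: (runs_seq (solve_runs ps)); first lia.
move=> s1 ag1 [least1 greatest1 solution1 dist1].
have ps1 := prepared_agree_off ag1 isT ps.
apply: (runs_seq (check_target_runs ps1 least1 greatest1)); first lia.
move=> s2 ag2 target2.
have ps2 := prepared_agree_off ag2 isT ps1.
have dist2 (v : 'I_m.+1) :
    rarr s2 dist_arr v = dist (cheapest_solution par t0 l w u c D C) v.
  by rewrite (agree_off_rarr ag2) // dist1.
apply: (runs_weaken (check_leaves_runs ps2 dist2)) => [|s3 ag3 leaves3]; first lia.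
split; last by rewrite leaves3 target2.
by apply: funext => e; rewrite (agree_off_rarr ag3) // (agree_off_rarr ag2).
Qed.

Lemma test_threshold_runs k s j :
  prepared s -> iarr s by_cost_arr (ireg s k) = j ->
  runs (test_threshold k) s (m.+1 * 410) (fun s' =>
    [/\ rreg s' threshold_reg = threshold c j,
        (fun e : 'I_m => rarr s' solution_arr (child e)) =
          cheapest_solution par t0 l w u c D (threshold c j)
      & 0 < ireg s' passed_reg <-> attainable par t0 l w u c D (threshold c j)]).
Proof.
move=> ps s_j; apply: runs_seq_loopfree => /=; first lia.
rewrite s_j (prepared_cost ps); set s1 := set_rreg _ _ _.
have ps1 : prepared s1 by case: ps; split.
apply: (runs_weaken (test_runs ps1)) => [|s2 ag2 [solution2 passed2]]; first lia.
have thresholdP := attainableP rooted t0 c D lwu (threshold_ge0 c_gt0 j).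
rewrite (agree_off_rreg ag2) //; split=> //.
by split=> [/passed2/thresholdP|/thresholdP/passed2].
Qed.

(** * Search for the least threshold *)

Definition passes (by_cost : nat -> nat) (j : nat) : Prop :=
  attainable par t0 l w u c D (threshold c (by_cost j)).

Lemma search_runs s : prepared s ->
  runs search s (1000 * (m.+1 * (trunc_log 2 m.+1).+1)) (fun s' =>
    least_index (passes (iarr s by_cost_arr)) m.+1 (ireg s' low_reg)).
Proof.
move=> ps; have by_cost := prepared_by_cost ps.
have mono j k : j <= k -> k < m.+1 -> passes (iarr s by_cost_arr) j ->
    passes (iarr s by_cost_arr) k.
  move=> jk kn; apply: attainable_mono.
  exact: sorts_le by_cost _ _ jk kn.
apply: (runs_weaken
  (binary_search_runs (B := m.+1 * 410) (prepared_nodes ps) mono _ _)) => //.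
- move=> s1 ag1 _; have ps1 := prepared_agree_off ag1 isT ps.
  apply: (runs_weaken (test_threshold_runs ps1 erefl)) => // s2 _ [_ _].
  by rewrite (agree_off_iarr ag1).
- have : trunc_log 2 m.+1 <= m.+1 * trunc_log 2 m.+1 by rewrite leq_pmull.
  by lia.
Qed.

Section LeastIndex.
Variables (by_cost : nat -> nat) (k : nat).
Hypotheses (by_costP : sorts (threshold c) m.+1 by_cost)
  (least_k : least_index (passes by_cost) m.+1 k).

Lemma least_index_infeasible :
  m < k -> ~ exists f, feasible par t0 l u D f.
Proof.
case: least_k => _ fails _ m_k [f /(attainable_objective w c)[v _]].
by have [j j_m <-] := sorts_surj by_costP (ltn_ord v); apply: fails; lia.
Qed.

Lemma least_index_optimal (C := threshold c (by_cost k))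
    (f := cheapest_solution par t0 l w u c D C) :
  k < m.+1 -> optimal par t0 l w u c D f /\ C = objective c w f.
Proof.
case: least_k => _ fails passes_k k_m.
apply: cheapest_solution_optimal => // [| |v attainable_v].
- exact: threshold_ge0.
- exact: passes_k.
have [j j_m v_j] := sorts_surj by_costP (ltn_ord v).
rewrite -v_j; apply: (sorts_le by_costP) => //; rewrite leqNgt.
by apply/negP => /fails; rewrite /passes v_j.
Qed.

End LeastIndex.

Lemma report_runs s : prepared s ->
  least_index (passes (iarr s by_cost_arr)) m.+1 (ireg s low_reg) ->
  runs report s (m.+1 * 420) (correct_output par t0 l w u c D).
Proof.
move=> ps least.
have cost_le : (3 + m.+1 * 415).+1 <= m.+1 * 420 by lia.
suff report_s : runs report s (3 + m.+1 * 415).+1 (correct_output par t0 l w u c D).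
  exact: runs_weaken report_s cost_le _.
apply: runs_if; rewrite /= (prepared_nodes ps) -?ltnNge => low_m.
  apply: runs_loopfree => /=; first lia.
  left; split=> //; exact: least_index_infeasible (prepared_by_cost ps) least low_m.
have [optimal_f value_f] := least_index_optimal (prepared_by_cost ps) least low_m.
apply: (runs_seq (test_threshold_runs ps erefl)); first lia.
move=> s1 _ [threshold1 solution1 _].
apply: runs_loopfree => /=; first lia.
by right; split=> //=; rewrite solution1 ?threshold1.
Qed.

End Solver.

Definition preprocess : cmd :=
  compute_depths ;;
  merge_sort depth_arr by_depth_arr ;;
  merge_sort cost_arr by_cost_arr ;;
  mark_path ;;
  mark_inner.

Definition solver : cmd := preprocess ;; search ;; report.

Section Correctness.
Variables (R : realType) (m : nat) (par : 'I_m -> 'I_m.+1) (t0 : 'I_m.+1).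
Variables (l w u c : 'I_m -> R) (D : R).
Hypothesis rooted : rooted_tree par.

Lemma preprocess_runs :
  runs preprocess (input par t0 l w u c D) (600 * (m.+1 * (trunc_log 2 m.+1).+1))
    (prepared par t0 l w u c D).
Proof.
have n_le : m.+1 <= m.+1 * (trunc_log 2 m.+1).+1 by rewrite leq_pmulr.
set s := input _ _ _ _ _ _ _.
apply: (runs_seq (compute_depths_runs (s := s) rooted erefl erefl)); first lia.
move=> s1 ag1 depth1.
have nodes1 : ireg s1 nodes_reg = m.+1 by rewrite (agree_off_ireg ag1).
apply: (runs_seq (merge_sort_runs depth_arr (arr := by_depth_arr) _ _ nodes1)) => //.
  by lia.
move=> s2 ag2 by_depth2.
have nodes2 : ireg s2 nodes_reg = m.+1 by rewrite (agree_off_ireg ag2).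
apply: (runs_seq (merge_sort_runs cost_arr (arr := by_cost_arr) _ _ nodes2)) => //.
  by lia.
move=> s3 ag3 by_cost3; have ag13 := agree_off_cat (agree_off_cat ag1 ag2) ag3.
have target3 : ireg s3 target_reg = t0 by rewrite (agree_off_ireg ag13).
have parent3 : iarr s3 parent_arr = parent_entry par by rewrite (agree_off_iarr ag13).
have unmarked3 (e : 'I_m) : iarr s3 on_path_arr (child e) = 0.
  by rewrite (agree_off_iarr ag13).
apply: (runs_seq (mark_path_runs rooted target3 parent3 unmarked3)); first lia.
move=> s4 ag4 path4; have ag14 := agree_off_cat ag13 ag4.
have nodes4 : ireg s4 nodes_reg = m.+1 by rewrite (agree_off_ireg ag14).
have parent4 : iarr s4 parent_arr = parent_entry par by rewrite (agree_off_iarr ag14).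
have unmarked4 (v : 'I_m.+1) : iarr s4 inner_arr v = 0.
  by rewrite (agree_off_iarr ag14).
apply: (runs_weaken (mark_inner_runs nodes4 parent4 unmarked4)); first lia.
move=> s5 ag5 inner5; have ag15 := agree_off_cat ag14 ag5.
have ag35 := agree_off_cat ag4 ag5; have ag25 := agree_off_cat ag3 ag35.
have depth5 : rarr s5 depth_arr = rarr s1 depth_arr.
  by rewrite (agree_off_rarr (agree_off_cat ag2 ag25)).
split; rewrite ?depth5 ?(agree_off_ireg ag15) ?(agree_off_rreg ag15)
  ?(agree_off_rarr ag15) //.
- by rewrite (agree_off_iarr ag15).
- by rewrite (agree_off_iarr ag25).
- rewrite (agree_off_rarr (agree_off_cat ag1 ag2)) // in by_cost3.
  by rewrite (agree_off_iarr ag35).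
- by move=> e; rewrite (agree_off_iarr ag5).
Qed.

Lemma solver_runs : (forall e, (l e <= w e <= u e)%R) -> (forall e, (0 < c e)%R) ->
  runs solver (input par t0 l w u c D) (2100 * (m.+1 * (trunc_log 2 m.+1).+1))
    (correct_output par t0 l w u c D).
Proof.
move=> lwu c_gt0.
have n_le : m.+1 <= m.+1 * (trunc_log 2 m.+1).+1 by rewrite leq_pmulr.
apply: (runs_seq preprocess_runs) => [|s1 ag1 ps1]; first lia.
apply: (runs_seq (search_runs rooted lwu c_gt0 ps1)) => [|s2 ag2 least2]; first lia.
have ps2 := prepared_agree_off ag2 isT ps1.
rewrite -(agree_off_iarr ag2) // in least2.
by apply: (runs_weaken (report_runs rooted lwu c_gt0 ps2 least2)) => //; lia.
Qed.

End Correctness.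

Local Open Scope ring_scope.

Theorem theorem3 (R : realType) :
  exists (p : cmd) (T : nat -> nat),
    O_nlogn T /\
    forall (m : nat) (par : 'I_m -> 'I_m.+1) (t0 : 'I_m.+1)
           (l w u c : 'I_m -> R) (D : R),
      rooted_tree par ->
      leaf par t0 ->
      (forall e, l e <= w e <= u e) ->
      (forall e, 0 < c e) ->
      exists (t : nat) (s : state R),
        [/\ exec p (input par t0 l w u c D) t s,
            (t <= T m.+1)%N
          & correct_output par t0 l w u c D s].
Proof.
exists solver, (fun n => 2100 * (n * (trunc_log 2 n).+1))%N; split.
  exists 4200, 2 => n n_ge2; have : (0 < trunc_log 2 n)%N by apply: trunc_log_max.
  by move: (trunc_log 2 n) => k; nia.
by move=> m par t0 l w u c D rooted _ lwu c_gt0; apply: solver_runs.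
Qed.
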